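(* Let $X$ be a metric space and $x\in X$. Assume there exist constants $c\ge1$, $a\in(0,1]$ such that for all $r\le a$, $\lambda,\mu\le1$ and $y,z\in B_X(x,r)$, $n(\lambda\mu r,B_X(y,\lambda r))\le c\,n(\lambda\mu r,B_X(z,\lambda r))$, and that $\limsup_{r\to0}n_{\lambda r}(\overline{B}_X(x,r))<\infty$ for all $\lambda>0$. Then $$\underline{\delta}_X(x)=\inf_{T\in\mathcal{T}_xX}\underline{d}(T)=\inf_{T\in\mathcal{T}_xX}\overline{d}(T),\qquad \overline{\delta}_X(x)=\sup_{T\in\mathcal{T}_xX}\underline{d}(T)=\sup_{T\in\mathcal{T}_xX}\overline{d}(T).$$
   Context: $B_X(x,r)$ open ball, $\overline{B}_X(x,r)$ closed ball; $n(s,A)=n_s(A)$ is the minimum number of open balls of radius $s$ needed to cover $A$. Tangential dimensions: $\underline{\delta}_X(x)=\liminf_{\lambda\to0}\liminf_{r\to0}\frac{\log n(\lambda r,\overline{B}_X(x,r))}{\log1/\lambda}$, $\overline{\delta}_X(x)=\limsup_{\lambda\to0}\limsup_{r\to0}\frac{\log n(\lambda r,\overline{B}_X(x,r))}{\log1/\lambda}$. A tangent set of $X$ at $x$ is any limit point as $t\to\infty$ of $(X,x,td)$ (metric rescaled by $t$, base point $x$) in the pointed Gromov–Hausdorff topology; $\mathcal{T}_xX$ is the set of tangent sets. For a metric space $T$ with base point $x$, the box dimensions are $\underline{d}(T)=\lim_{R\to\infty}\liminf_{r\to0}\frac{\log n(r,B_T(x,R))}{\log1/r}$ and $\overline{d}(T)=\lim_{R\to\infty}\limsup_{r\to0}\frac{\log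 n(r,B_T(x,R))}{\log1/r}$. *)

(* Defs.v *)
From HB Require Import structures.
From mathcomp Require Import all_boot all_order all_algebra.
From mathcomp Require Import all_classical all_reals all_analysis.
Set Implicit Arguments. Unset Strict Implicit. Unset Printing Implicit Defensive.
Import Order.TTheory GRing.Theory Num.Theory.
Import numFieldNormedType.Exports.
Local Open Scope classical_set_scope.
Local Open Scope ring_scope.

Section Defs.
Variable R : realType.

Definition is_metric (X : Type) (d : X -> X -> R) : Prop :=
  (forall a b, 0 <= d a b) /\ (forall a b, d a b = 0 <-> a = b) /\
  (forall a b, d a b = d b a) /\ (forall a b c, d a c <= d a b + d b c).

Definition oball (X : Type) (d : X -> X -> R) (c : X) (r : R) : set X :=
  [set y | d c y < r].
Definition cball (X : Type) (d : X -> X -> R) (c : X) (r : R) : set X :=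
  [set y | d c y <= r].

(* n(s, A): minimal number of open balls of radius s (centred in X) covering A;
   +oo if no finite cover exists *)
Definition covnum (X : Type) (d : X -> X -> R) (s : R) (A : set X) : \bar R :=
  ereal_inf [set ((N%:R)%:E : \bar R) | N in
    [set N : nat | exists f : 'I_N -> X, A `<=` \bigcup_(i in setT) oball d (f i) s]].

Definition elog (v : \bar R) : \bar R :=
  match v with
  | EFin r => (ln r)%:E
  | +oo%E => +oo%E
  | -oo%E => -oo%E
  end.

Definition tang_ratio (X : Type) (d : X -> X -> R) (x : X) (lam r : R) : \bar R :=
  (elog (covnum d (lam * r) (cball d x r)) * ((ln (lam^-1))^-1)%:E)%E.

Definition tang_dim_low (X : Type) (d : X -> X -> R) (x : X) : \bar R :=
  limf_einf (fun lam => limf_einf (fun r => tang_ratio d x lam r) (0^'+)) (0^'+).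
Definition tang_dim_up (X : Type) (d : X -> X -> R) (x : X) : \bar R :=
  limf_esup (fun lam => limf_esup (fun r => tang_ratio d x lam r) (0^'+)) (0^'+).

Definition box_ratio (T : Type) (dT : T -> T -> R) (p : T) (Rad r : R) : \bar R :=
  (elog (covnum dT r (oball dT p Rad)) * ((ln (r^-1))^-1)%:E)%E.
Definition box_dim_low (T : Type) (dT : T -> T -> R) (p : T) : \bar R :=
  lim ((limf_einf (fun r => box_ratio dT p Rad r) (0^'+)) @[Rad --> +oo]).
Definition box_dim_up (T : Type) (dT : T -> T -> R) (p : T) : \bar R :=
  lim ((limf_esup (fun r => box_ratio dT p Rad r) (0^'+)) @[Rad --> +oo]).

(* Pointed Gromov--Hausdorff convergence (Burago--Burago--Ivanov, Def. 8.1.1)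
   of the pointed spaces (X, D k, p) to (Y, dY, q) as k -> oo. *)
Definition pGH_conv (X : Type) (D : nat -> X -> X -> R) (p : X)
  (Y : Type) (dY : Y -> Y -> R) (q : Y) : Prop :=
  forall r eps : R, 0 < r -> 0 < eps ->
  exists k0 : nat, forall k : nat, (k0 <= k)%N ->
  exists f : X -> Y,
    f p = q /\
    (forall a b, D k p a < r -> D k p b < r -> `|dY (f a) (f b) - D k a b| < eps) /\
    (forall y, dY q y < r - eps -> exists a, D k p a < r /\ dY (f a) y < eps).

Definition is_tangent (X : Type) (d : X -> X -> R) (x : X)
  (T : Type) (dT : T -> T -> R) (q : T) : Prop :=
  is_metric dT /\
  exists t : nat -> R, (forall M : R, exists k0 : nat, forall k, (k0 <= k)%N -> M < t k) /\
    pGH_conv (fun k a b => t k * d a b) x dT q.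

Definition tangent_low_dims (X : Type) (d : X -> X -> R) (x : X) : set (\bar R) :=
  [set v | exists (T : Type) (dT : T -> T -> R) (q : T),
      is_tangent d x dT q /\ v = box_dim_low dT q].
Definition tangent_up_dims (X : Type) (d : X -> X -> R) (x : X) : set (\bar R) :=
  [set v | exists (T : Type) (dT : T -> T -> R) (q : T),
      is_tangent d x dT q /\ v = box_dim_up dT q].

End Defs.

(* Main.v *)
(** Write [n s r] for the covering number of the open ball [B(x, r)] by balls
of radius [s]. Homogeneity and finiteness make [n] quasi-multiplicative:
[n s r] and [n t r * n s t] agree up to a bounded factor for [s <= t <= r]
small; one bound comes from refining a cover of [B(x, r)] by [t]-balls, the
other from counting the [s]-balls needed near [t]-separated points.

A tangent set along scales [s -> 0] has covering numbers trapped between those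
of [X] at scales proportional to [s], so its box dimensions lie between the two
tangential dimensions. Conversely, if [log n (lam * r) r] is larger than
[al * log (1 / lam)] at some pair of scales, then minimising
[i |-> log n (e^-i * r) r - be * i] with [be < al] produces a scale
[s = e^-i * r] at which [log n (e^-j * s) s >= be * j - C] for all [j] up to an
arbitrarily large bound. A tangent set along such scales, obtained as an
ultralimit of rescalings of [X], has lower box dimension at least [be]. The
lower tangential dimension is treated in the same way with the signs
reversed. *)

Require Import Defs.
From HB Require Import structures.
From mathcomp Require Import all_boot all_order all_algebra.
From mathcomp Require Import all_classical all_reals all_analysis.
From mathcomp Require Import ring lra.
Import Order.TTheory GRing.Theory Num.Theory.
Import numFieldNormedType.Exports.
Local Open Scope classical_set_scope.
Local Open Scope ring_scope.

(** * Covering numbers *)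

(** Only the first [N] terms of the sequence count. Compared with a family indexed by ['I_N], this
    makes reindexing and enlarging [N] immediate, at the price of needing a point of [X] as
    filler. *)
Definition covers {R : realType} {X : Type} (d : X -> X -> R) (s : R)
    (A : set X) (N : nat) :=
  exists f : nat -> X, forall y, A y -> exists2 i, (i < N)%N & d (f i) y < s.

Section Covers.
Context {R : realType} {X : Type} (d : X -> X -> R).
Implicit Types (x y : X) (r s t : R) (A B : set X).

Lemma covers_le s s' A A' M N : (M <= N)%N -> s' <= s -> A `<=` A' ->
  covers d s' A' M -> covers d s A N.
Proof.
move=> MN ss' AA' [f hf]; exists f => y /AA' /hf [i iM iy].
by exists i; [exact: leq_trans MN|exact: lt_le_trans ss'].
Qed.

(** An infimum of naturals that is at most [N] is below [N + 1], so some cover has [M < N + 1]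
    balls; [x] pads the finite family to a sequence. *)
Lemma covnum_le_natP x s A N : (covnum d s A <= N%:R%:E)%E <-> covers d s A N.
Proof.
split=> [le|[f hf]].
- have /ereal_inf_lt [_ /= [M [f hf] <-] MN] : (covnum d s A < N.+1%:R%:E)%E.
    by apply: le_lt_trans le _; rewrite lte_fin ltr_nat.
  rewrite lte_fin ltr_nat ltnS in MN.
  exists (fun i => if insub i is Some j then f j else x) => y /hf [j _ yj].
  by exists j; [exact: leq_trans MN|rewrite valK].
- apply: ereal_inf_lbound; exists N => //=.
  by exists (fun i => f i) => y /hf [i iN yi]; exists (Ordinal iN).
Qed.

Lemma covnum_nat x s A :
  covnum d s A = +oo%E \/ exists N, covnum d s A = N%:R%:E.
Proof.
have [ex|nex] := pselect (exists N, `[< covers d s A N >]).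
- right; exists (ex_minn ex); case: ex_minnP => M /asboolP cM minM.
  apply/eqP; rewrite eq_le; apply/andP; split; first exact/(covnum_le_natP x).
  apply: le_ereal_inf_tmp => _ /= [N [f hf] <-]; rewrite lee_fin ler_nat.
  apply/minM/asboolP/(covnum_le_natP x)/ereal_inf_lbound.
  by exists N => //; exists f.
- left; apply/eqP; rewrite -leye_eq; apply: le_ereal_inf_tmp => _ /= [N [f hf] <-].
  exfalso; apply: nex; exists N; apply/asboolP/(covnum_le_natP x).
  by apply: ereal_inf_lbound; exists N => //; exists f.
Qed.

Lemma covnum_ge1 x s A : A x -> (1 <= covnum d s A)%E.
Proof.
move=> Ax; apply: le_ereal_inf_tmp => _ /= [[|N] [f hf] <-].
  by have [[]] := hf _ Ax.
by rewrite lee_fin ler1n.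
Qed.

(** Each of the [P] balls is refined by [Q] balls of radius [s]. Only balls that meet [A] need
    refining. *)
Lemma covers_comp s t A P Q : covers d t A P ->
  (forall y z, A z -> d y z < t -> covers d s (oball d y t) Q) ->
  covers d s A (P * Q).
Proof.
move=> [f hf] hQ.
have /choice[g hg] i : exists g : nat -> X, forall z y, A z -> d (f i) z < t ->
    d (f i) y < t -> exists2 j, (j < Q)%N & d (g j) y < s.
  have [[z [Az zt]]|nz] := pselect (exists z, A z /\ d (f i) z < t).
    by have [g hg] := hQ _ _ Az zt; exists g => z' y _ _ /hg.
  by exists f => z y Az zt; exfalso; apply: nz; exists z.
(* The pair [(i, j)] is coded by [i * Q + j]. *)
exists (fun l => g (l %/ Q)%N (l %% Q)%N) => y Ay.
have [i iP iy] := hf _ Ay; have [j jQ jy] := hg _ _ _ Ay iy iy.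
have Q0 : (0 < Q)%N by exact: leq_ltn_trans jQ.
exists (i * Q + j)%N; last by rewrite divnMDl// modnMDl divn_small// addn0 modn_small.
by rewrite (@leq_trans (i.+1 * Q))// ?leq_mul2r ?iP ?orbT// mulSn addnC ltn_add2r.
Qed.

(** Greedy choice: if no further point of [A] were at distance at least [t] from the points chosen
    so far, these points would be the centres of a cover that is too small. *)
Lemma separated_points x t A P : (forall N, (N < P)%N -> ~ covers d t A N) ->
  exists p : nat -> X, (forall i, (i < P)%N -> A (p i)) /\
    (forall i j, (i < j < P)%N -> t <= d (p i) (p j)).
Proof.
elim: P => [|P IH] nc.
  by exists (fun=> x); split=> // i j; rewrite ltn0 andbF.
have [N NP|p [pA psep]] := IH; first by apply: nc; rewrite ltnS ltnW.
have [y [Ay yp]] : exists y, A y /\ forall i, (i < P)%N -> t <= d (p i) y.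
  apply: contrapT => ny; apply: (nc P) => //; exists p => y Ay.
  apply: contrapT => ni; apply: ny; exists y; split=> // i iP.
  by rewrite leNgt; apply/negP => iy; apply: ni; exists i.
exists (fun i => if (i < P)%N then p i else y); split=> [i _|i j /andP[ij]].
  by case: ifPn => // /pA.
rewrite ltnS leq_eqVlt => /predU1P[jP|jP].
  by rewrite jP ltnn; rewrite jP in ij; rewrite ij yp.
by rewrite jP (ltn_trans ij jP) psep// ij.
Qed.

Hypothesis hd : is_metric d.

(* A ball of radius [s <= t] meets at most one of the balls
   [oball d (p i) t], the centres being [4 * t]-separated. *)
Lemma separated_covers (p : nat -> X) s t B P Q N : s <= t ->
  (forall i j, (i < j < P)%N -> 4 * t <= d (p i) (p j)) ->
  (forall i, (i < P)%N -> oball d (p i) t `<=` B) ->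
  (forall i M, (i < P)%N -> covers d s (oball d (p i) t) M -> (Q <= M)%N) ->
  covers d s B N -> (P * Q <= N)%N.
Proof.
move: hd => [_ [_ [dsym dtri]]] st psep pB hQ [f hf].
(* [I i l] says that the ball number [l] of the cover meets [oball d (p i) t]. At least [Q] balls do
   so for each [i], and each [l] serves at most one [i]; counting the pairs in two ways gives the
   bound. *)
pose I (i : 'I_P) (l : 'I_N) := `[< exists z, d (f l) z < s /\ d (p i) z < t >].
have QI (i : 'I_P) : (Q <= #|[pred l | I i l]|)%N.
  apply: (hQ i _ (ltn_ord i)).
  exists (fun j => f (nth 0%N [seq val l | l <- enum [pred l | I i l]] j)).
  move=> y yt; have [l lN ly] := hf _ (pB _ (ltn_ord i) _ yt).
  pose l' := Ordinal lN.
  have l'I : l' \in enum [pred l | I i l].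
    by rewrite mem_enum inE; exists y.
  exists (index l' (enum [pred l | I i l])); first by rewrite cardE index_mem.
  by rewrite (nth_map l') ?index_mem// nth_index.
apply: (@leq_trans (\sum_(i < P) #|[pred l | I i l]|)).
  rewrite -[X in (X * _)%N](card_ord P) -sum_nat_const.
  exact: leq_sum.
under eq_bigr do rewrite -sum1_card big_mkcond.
rewrite exchange_big/= -[leqRHS](card_ord N) -sum1_card; apply: leq_sum => l _.
rewrite -big_mkcond sum1_card; apply/card_le1_eqP => i j.
rewrite !inE => -[z [lz iz]] [z' [lz' jz']].
have key (k m : 'I_P) w w' : (k < m)%N -> d (f l) w < s -> d (p k) w < t ->
    d (f l) w' < s -> d (p m) w' < t -> False.
  move=> km lw kw lw' mw'; have := psep k m.
  rewrite km ltn_ord => /(_ isT).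
  have := dtri (p k) w (p m); have := dtri w (f l) (p m).
  have := dtri (f l) w' (p m); rewrite (dsym w (f l)) (dsym w' (p m)).
  lra.
by case: (ltngtP i j) => [ij|ij|/val_inj//]; exfalso;
  [exact: (key i j z z')|exact: (key j i z' z)].
Qed.

End Covers.

Section CompareCovers.
Context {R : realType} {X Y : Type} (d : X -> X -> R) (d' : Y -> Y -> R).

Lemma le_covnum (x : X) (y : Y) s A s' A' :
  (forall N, covers d' s' A' N -> covers d s A N) ->
  (covnum d s A <= covnum d' s' A')%E.
Proof.
move=> h; have [->|[N cN]] := covnum_nat d' y s' A'; first exact: leey.
rewrite cN; apply/(covnum_le_natP _ x)/h/(covnum_le_natP _ y); by rewrite cN.
Qed.

End CompareCovers.

(** * Ultralimits and pointed Gromov-Hausdorff convergence *)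

(** Otherwise all the complements are in [U], and so is their finite intersection, which is disjoint
    from the union. *)
Lemma ultra_bigU {T : Type} (U : set_system T) (P : nat -> set T) N :
  UltraFilter U -> U [set k | exists2 i, (i < N)%N & P i k] ->
  exists2 i, (i < N)%N & U (P i).
Proof.
move=> UU UP; apply: contrapT => nU.
have UC : U [set k | forall i : 'I_N, ~ P i k].
  apply: filter_forall => i; have [UPi|//] := in_ultra_setVsetC (P i) UU.
  by exfalso; apply: nU; exists i.
have [k [[i iN Pik] nP]] := filter_ex (filterI UP UC).
exact: (nP (Ordinal iN)).
Qed.

(** By compactness of [[m, M]] the image of [U] has a cluster point, and a cluster point of an
    ultrafilter is a limit. *)
Lemma ultra_limit {R : realType} {T : Type} (U : set_system T) (u : T -> R) m M :
  UltraFilter U -> U [set k | m <= u k <= M] ->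
  exists l, forall e, 0 < e -> U [set k | `|l - u k| < e].
Proof.
move=> UU Ub.
have Ub' : (u x @[x --> U]) `[m, M]%classic.
  by rewrite /fmap/=; apply: filterS Ub => k; rewrite /= in_itv.
have [l [_ lU]] := @segment_compact R m M _ _ Ub'.
exists l => e e0.
have [//|UC] := in_ultra_setVsetC [set k | `|l - u k| < e] UU.
by have [y [nly]] := lU (~` ball l e) (ball l e) UC (nbhsx_ballx l e e0).
Qed.

Section MetricQuotient.
Context {R : realType} {S : Type} (dS : S -> S -> R).
Hypotheses (dS_ge0 : forall a b, 0 <= dS a b) (dSxx : forall a, dS a a = 0).
Hypotheses (dSC : forall a b, dS a b = dS b a).
Hypothesis (dS_tri : forall a b c, dS a c <= dS a b + dS b c).

(** Points at distance 0 are identified: a point of [T] is an equivalence class, seen as a subset of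
    [S], and distances are read off chosen representatives. *)
Lemma metric_quotient : exists (T : Type) (dT : T -> T -> R) (pi : S -> T),
  [/\ is_metric dT, forall a b, dT (pi a) (pi b) = dS a b &
      forall y, exists a, y = pi a].
Proof.
pose cl a := [set b | dS a b = 0].
pose T := {A : set S | exists a, A = cl a}.
pose rep (y : T) : S := sval (cid (svalP y)).
have repP (y : T) : sval y = cl (rep y) by exact: svalP (cid (svalP y)).
pose pi a : T := exist _ (cl a) (ex_intro _ a erefl).
have dS_eq a a' b : dS a a' = 0 -> dS a b = dS a' b.
  move=> aa'; apply/eqP; rewrite eq_le.
  have := dS_tri a a' b; have := dS_tri a' a b.
  by rewrite (dSC a' a) aa' !add0r => -> ->.
have rep_pi a : dS (rep (pi a)) a = 0.
  have := repP (pi a) => /= /(congr1 (fun A => A a)) E.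
  by suff : cl (rep (pi a)) a by []; rewrite -E; exact: dSxx.
have rep_inj y y' : dS (rep y) (rep y') = 0 -> y = y'.
  move=> yy'; apply: eq_sig_hprop => [A|]; first exact: Prop_irrelevance.
  rewrite !repP; apply/seteqP; split => b /=.
    by rewrite /cl/= (dS_eq _ _ _ yy').
  by rewrite /cl/= -(dS_eq _ _ _ yy').
exists T, (fun y y' => dS (rep y) (rep y')), pi; split.
- split=> [a b|]; first exact: dS_ge0.
  split=> [a b|]; first by split=> [|->]; [exact: rep_inj|exact: dSxx].
  by split=> a b; [exact: dSC|move=> e; exact: dS_tri].
- move=> a b; rewrite (dS_eq _ _ _ (rep_pi a)).
  by rewrite dSC (dS_eq _ _ _ (rep_pi b)) dSC.
- by move=> y; exists (rep y); apply: rep_inj; rewrite dSC rep_pi.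
Qed.

End MetricQuotient.

(** The condition that [pGH_conv] imposes at a single index, isolated so that the set of indices
    satisfying it can be tested against an ultrafilter. *)
Definition GH_approx {R : realType} {X Y : Type} (D : X -> X -> R) (p : X)
    (dY : Y -> Y -> R) (q : Y) (r eps : R) :=
  exists f : X -> Y,
    f p = q /\
    (forall a b, D p a < r -> D p b < r -> `|dY (f a) (f b) - D a b| < eps) /\
    (forall y, dY q y < r - eps -> exists a, D p a < r /\ dY (f a) y < eps).

(** The factor 2 is for the almost surjectivity: the point [a] given by the finer approximation must
    be shown to lie in the smaller ball, which costs [eps'] for [y] and [eps'] for the
    distortion. *)
Lemma GH_approx_le {R : realType} {X Y : Type} (D : X -> X -> R) (p : X)
    (dY : Y -> Y -> R) (q : Y) (r r' eps eps' : R) :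
  is_metric D -> is_metric dY -> 0 < eps' -> r <= r' -> 2 * eps' <= eps ->
  GH_approx D p dY q r' eps' -> GH_approx D p dY q r eps.
Proof.
move=> [D0 [DE _]] [dY0 [_ [dYC dYT]]] e'0 rr ee [f [fp [fD fS]]]; exists f.
have pp : D p p = 0 by exact/DE.
split=> //; split => [a b pa pb|y qy].
  by apply: lt_le_trans (fD a b (lt_le_trans pa rr) (lt_le_trans pb rr)) _; lra.
have [|a [pa ay]] := fS y.
  by have := dY0 q y; lra.
have r'0 : 0 < r' by exact: le_lt_trans (D0 _ _) pa.
have := fD p a; rewrite pp fp => /(_ r'0 pa); rewrite ltr_norml => /andP[].
exists a; split; last by have := dY0 (f a) y; lra.
have := dYT q y (f a); rewrite (dYC y); lra.
Qed.

Section UltraLimit.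
Context {R : realType} {X : Type} (D : nat -> X -> X -> R) (x : X).
Hypothesis hD : forall k, is_metric (D k).
Hypothesis totb : forall r eps : R, 0 < r -> 0 < eps ->
  exists N k1, forall k, (k1 <= k)%N -> covers (D k) eps (oball (D k) x r) N.

(* The limit space is the ultraproduct of the [(X, D k)] along [U], restricted
   to the sequences staying at bounded distance from [x]. *)
Lemma ultralimit (U : set_system nat) : UltraFilter U -> \oo `<=` U ->
  exists (T : Type) (dT : T -> T -> R) (q : T), is_metric dT /\
    forall r eps : R, 0 < r -> 0 < eps ->
      U [set k | GH_approx (D k) x dT q r eps].
Proof.
move=> UU Uoo.
have D0 k := (hD k).1; have DE k := (hD k).2.1.
have DC k := (hD k).2.2.1; have DT k := (hD k).2.2.2.
have Dxx k y : D k y y = 0 by exact/DE.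
pose S := {b : nat -> X | exists M, forall k, D k x (b k) <= M}.
pose close (b b' : S) l :=
  forall e, 0 < e -> U [set k | `|l - D k (sval b k) (sval b' k)| < e].
have /choice[dS2 dS2P] (bb' : S * S) : exists l, close bb'.1 bb'.2 l.
  case: bb' => [[b [M bM]] [b' [M' b'M]]].
  apply: (@ultra_limit _ _ _ (fun k => D k (b k) (b' k)) 0 (M + M')).
  apply: Uoo; exists 0%N => // k _ /=; rewrite D0/=.
  by have := DT k (b k) x (b' k); have := bM k; have := b'M k; rewrite (DC k _ x); lra.
pose dS b b' := dS2 (b, b').
have dSP b b' e : 0 < e ->
    U [set k | `|dS b b' - D k (sval b k) (sval b' k)| < e].
  exact: (dS2P (b, b')).
(* Each axiom of a pseudometric passes to the limit: up to an error [e] it is read off at one index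
   in a finite intersection of sets of [U]. *)
have dS_ge0 b b' : 0 <= dS b b'.
  apply/ler_addgt0Pl => e e0; have [k /=] := filter_ex (dSP b b' e e0).
  by rewrite ltr_norml; have := D0 k (sval b k) (sval b' k); lra.
have dSxx b : dS b b = 0.
  apply/eqP; rewrite eq_le dS_ge0 andbT; apply/ler_addgt0Pl => e e0.
  by have [k /=] := filter_ex (dSP b b e e0); rewrite Dxx ltr_norml; lra.
have dSC b b' : dS b b' = dS b' b.
  apply/eqP; rewrite eq_le; apply/andP; split; apply/ler_addgt0Pl => e e0.
    have e2 : 0 < e / 2 by lra.
    have [k /= []] := filter_ex (filterI (dSP b b' _ e2) (dSP b' b _ e2)).
    by rewrite (DC k (sval b' k)) !ltr_norml; lra.
  have e2 : 0 < e / 2 by lra.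
  have [k /= []] := filter_ex (filterI (dSP b b' _ e2) (dSP b' b _ e2)).
  by rewrite (DC k (sval b' k)) !ltr_norml; lra.
have dS_tri b1 b2 b3 : dS b1 b3 <= dS b1 b2 + dS b2 b3.
  apply/ler_addgt0Pl => e e0; have e3 : 0 < e / 3 by lra.
  have [k /= [[]]] := filter_ex
    (filterI (filterI (dSP b1 b2 _ e3) (dSP b2 b3 _ e3)) (dSP b1 b3 _ e3)).
  by rewrite !ltr_norml; have := DT k (sval b1 k) (sval b2 k) (sval b3 k); lra.
have [T [dT [pi [mT dTE pi_surj]]]] := metric_quotient _ dS_ge0 dSxx dSC dS_tri.
have x_bnd : exists M, forall k, D k x x <= M by exists 0 => k; rewrite Dxx.
pose xS : S := exist _ (fun=> x) x_bnd.
exists T, dT, (pi xS); split=> // r eps r0 eps0.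
(* Three errors of size [e] add up below: at most two from the net and one from comparing [dS] with
   [D k]. *)
pose e := eps / 4; have e0 : 0 < e by rewrite /e; lra.
have [N [k1 cov]] := totb r e r0 e0.
have /choice[c0 c0P] k : exists c : nat -> X, (k1 <= k)%N ->
    forall y, D k x y < r -> exists2 i, (i < N)%N & D k (c i) y < e.
  have [k1k|k1k] := leqP k1 k; last by exists (fun=> x).
  by have [c cP] := cov k k1k; exists c => _; exact: cP.
(* Centres at distance [r + e] or more from [x] cover no point of the ball; replacing them by [x]
   keeps every sequence [c ^~ i] bounded, hence in [S]. The extra index [N] always stands for
   [x]. *)
pose c k i := if (i < N)%N && (D k x (c0 k i) < r + e) then c0 k i else x.
have cN k : c k N = x by rewrite /c ltnn.
have cP k : (k1 <= k)%N ->
    forall y, D k x y < r -> exists2 i, (i < N)%N & D k (c k i) y < e.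
  move=> k1k y yr; have [i iN iy] := c0P k k1k y yr; exists i => //.
  rewrite /c iN /= ifT//.
  by have := DT k x y (c0 k i); rewrite (DC k y); lra.
have c_bnd i : exists M, forall k, D k x (c k i) <= M.
  exists (r + e) => k; rewrite /c; case: ifPn => [/andP[_ /ltW//]|_].
  by rewrite Dxx; lra.
pose g i : S := exist _ (fun k => c k i) (c_bnd i).
have gN : dS xS (g N) = 0.
  apply/eqP; rewrite eq_le dS_ge0 andbT; apply/ler_addgt0Pl => t t0.
  by have [k /=] := filter_ex (dSP xS (g N) t t0); rewrite cN Dxx ltr_norml; lra.
have gNE : pi xS = pi (g N) by apply/mT.2.1; rewrite dTE.
(* There are finitely many pairs of net points, so one set of [U] serves them all. *)
have UE : U [set k | forall ij : 'I_N.+1 * 'I_N.+1,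
    `|dS (g ij.1) (g ij.2) - D k (c k ij.1) (c k ij.2)| < e].
  by apply: filter_forall => ij; exact: (dSP (g ij.1) (g ij.2)).
have Uk1 : U [set k | (k1 <= k)%N] by apply: Uoo; exists k1.
apply: filterS (filterI Uk1 UE) => k [/= k1k {}UE].
have gD i j : (i <= N)%N -> (j <= N)%N ->
    `|dT (pi (g i)) (pi (g j)) - D k (c k i) (c k j)| < e.
  by move=> iN jN; rewrite dTE; exact: (UE (Ordinal (iN : (i < N.+1)%N),
    Ordinal (jN : (j < N.+1)%N))).
(* [h] sends a point to the index of a nearby net point. The base point is sent to [N], so that it
   is preserved exactly; [N] is also the default outside the ball. *)
have /choice[h hP] y : exists i, [/\ (i <= N)%N, y = x -> i = N &
    D k x y < r -> D k (c k i) y < e].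
  have [->|yx] := pselect (y = x).
    by exists N; split=> // _; rewrite cN Dxx.
  have [yr|yr] := ltP (D k x y) r; last by exists N.
  by have [i iN iy] := cP k k1k y yr; exists i; split=> //; exact: ltnW.
exists (fun y => pi (g (h y))); split; [|split].
- by have [_ -> //] := hP x.
- move=> y z yr zr; have [hy _ /(_ yr) {}yr] := hP y.
  have [hz _ /(_ zr) {}zr] := hP z; have := gD _ _ hy hz; rewrite !ltr_norml.
  have := DT k (c k (h y)) y (c k (h z)); have := DT k y z (c k (h z)).
  have := DT k y (c k (h y)) z; have := DT k (c k (h y)) (c k (h z)) z.
  rewrite (DC k y (c k (h y))) (DC k z (c k (h z))) /e in yr zr e0 *; lra.
- move=> y; have [b ->] := pi_surj y; rewrite gNE dTE => qb.
  (* For [U]-many indices [m] the sequence [b] is within [e] of some net point. Finitely many net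
     points share these indices, so a single [i] works for [U]-many [m], and [b] is within [e] of
     [g i] in the limit. *)
  have Ub : U [set k | exists2 i, (i < N)%N & D k (c k i) (sval b k) < e].
    have t0 : 0 < r - dS (g N) b by lra.
    apply: filterS (filterI Uk1 (dSP (g N) b _ t0)) => m [/= k1m].
    rewrite cN ltr_norml => bm; apply: cP k1m _ _; lra.
  have [i iN Ui] := ultra_bigU _ (fun i m => D m (c m i) (sval b m) < e) _ UU Ub.
  have ib : dS (g i) b <= e.
    apply/ler_addgt0Pl => t t0; have [m /= []] :=
      filter_ex (filterI Ui (dSP (g i) b _ t0)).
    rewrite ltr_norml; lra.
  have xi : D k x (c k i) < r.
    have := gD _ _ (leqnn N) (ltnW iN); rewrite dTE cN ltr_norml.
    have := dS_tri (g N) b (g i); rewrite (dSC b) /e in ib e0 *; lra.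
  exists (c k i); split=> //.
  have [hN _ /(_ xi) hi] := hP (c k i).
  have := gD _ _ hN (ltnW iN); rewrite !dTE ltr_norml.
  have := dS_tri (g (h (c k i))) (g i) b; rewrite /e in ib e0 hi *; lra.
Qed.

(** The ultrafilter refines [\oo], so each of its sets meets every tail. Diagonally, [phi m >= m] is
    an index with an approximation on radius [m + 1] with error [1 / (m + 1)]. *)
Lemma GH_subsequence : exists (T : Type) (dT : T -> T -> R) (q : T),
  is_metric dT /\ exists phi : nat -> nat, (forall m, (m <= phi m)%N) /\
    pGH_conv (fun m => D (phi m)) x dT q.
Proof.
have [U [UU Uoo]] := ultraFilterLemma (eventually_filter : ProperFilter \oo).
have [T [dT [q [mT hT]]]] := ultralimit _ UU Uoo.
exists T, dT, q; split=> //.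
have /choice[phi phiP] m : exists k, (m <= k)%N /\
    GH_approx (D k) x dT q m.+1%:R m.+1%:R^-1.
  have Um : U [set k | (m <= k)%N] by apply: Uoo; exists m.
  have [||k [/= mk hk]] := filter_ex (filterI Um (hT m.+1%:R m.+1%:R^-1 _ _)).
  - by rewrite ltr0n.
  - by rewrite invr_gt0 ltr0n.
  by exists k.
exists phi; split=> [m|r eps r0 eps0]; first by have [] := phiP m.
have [k0 hk0] : exists k0, forall k, (k0 <= k)%N -> r <= k.+1%:R /\ 2 * k.+1%:R^-1 <= eps.
  have mx0 : 0 <= Num.max r (2 / eps) by rewrite le_max ltW.
  exists (Num.bound (Num.max r (2 / eps))) => k kk.
  have : Num.max r (2 / eps) < k.+1%:R.
    apply: lt_le_trans (archi_boundP mx0) _; rewrite ler_nat.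
    exact: leq_trans kk _.
  rewrite gt_max => /andP[/ltW -> H]; split=> //.
  by rewrite ler_pdivrMr ?ltr0n// mulrC -ler_pdivrMr// ltW.
exists k0 => k /hk0[rk ek]; have [_ hk] := phiP k.
by apply: GH_approx_le rk ek hk => //; rewrite invr_gt0 ltr0n.
Qed.

End UltraLimit.

(** * Covering numbers of tangent sets *)

Section GHCovers.
Context {R : realType} {X Y : Type} (D : X -> X -> R) (p : X).
Context (dY : Y -> Y -> R) (q : Y).
Hypotheses (mD : is_metric D) (mY : is_metric dY).

(** The centres are pushed forward by [f]. A centre that covers a point of the ball of radius [S']
    is within [S' + rho' <= r] of [p], where [f] is almost isometric. *)
Lemma GH_covers_limit r eps rho rho' S S' N : GH_approx D p dY q r eps ->
  0 < S -> 0 < eps -> 0 < rho' -> S + 2 * eps <= S' -> rho' + 2 * eps <= rho ->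
  S' + rho' <= r ->
  covers D rho' (oball D p S') N -> covers dY rho (oball dY q S) N.
Proof.
move: mD mY => [D0 [DE [DC DT]]] [Y0 [_ [YC YT]]].
move=> [f [fp [fD fS]]] S0 e0 rho0 SS rr Sr [g hg].
have pp : D p p = 0 by exact/DE.
exists (f \o g) => y yS; rewrite /oball/= in yS.
have [|a [ar ay]] := fS y; first lra.
have pr : D p p < r by rewrite pp; lra.
have := fD p a pr ar; rewrite fp ltr_norml => /andP[pa _].
have qfa := YT q y (f a); rewrite (YC y) in qfa.
have [i iN ia] := hg a ltac:(rewrite /oball/=; lra).
exists i => //=.
have gir : D p (g i) < r by have := DT p a (g i); rewrite (DC a); lra.
have := fD (g i) a gir ar; rewrite ltr_norml => /andP[_ ga].
have := YT (f (g i)) (f a) y; lra.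
Qed.

(** Each centre within [r - eps] of [q] is pulled back to a point mapped close to it; the additional
    [eps] in the bound on [r] ensures that the centres in use are of this kind. The others get the
    default [p]. *)
Lemma GH_covers_space r eps rho rho' S S' N : GH_approx D p dY q r eps ->
  0 < S -> 0 < eps -> 0 < rho' -> S + 2 * eps <= S' -> rho' + 2 * eps <= rho ->
  S' + rho' + eps <= r ->
  covers dY rho' (oball dY q S') N -> covers D rho (oball D p S) N.
Proof.
move: mD mY => [D0 [DE [DC DT]]] [Y0 [_ [YC YT]]].
move=> [f [fp [fD fS]]] S0 e0 rho0 SS rr Sr [g hg].
have pp : D p p = 0 by exact/DE.
have pr : D p p < r by rewrite pp; lra.
have /choice[b bP] i : exists a, dY q (g i) < r - eps ->
    D p a < r /\ dY (f a) (g i) < eps.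
  have [/fS[a ha]|gr] := ltP (dY q (g i)) (r - eps); first by exists a.
  by exists p.
exists b => a; rewrite /oball/= => aS.
have ar : D p a < r by lra.
have := fD p a pr ar; rewrite fp ltr_norml => /andP[_ pa].
have [i iN ia] := hg (f a) ltac:(rewrite /oball/=; lra).
exists i => //.
have [|bir bi] := bP i; first by have := YT q (f a) (g i); rewrite (YC (f a)); lra.
have := fD _ _ bir ar; rewrite ltr_norml => /andP[ba _].
have := YT (f (b i)) (g i) (f a); lra.
Qed.

End GHCovers.

Section Scaling.
Context {R : realType} {X : Type} (d : X -> X -> R).

Lemma scale_metric t : 0 < t -> is_metric d -> is_metric (fun a b => t * d a b).
Proof.
move=> t0 [d0 [dE [dC dT]]]; split; first by move=> a b; rewrite mulr_ge0// ltW.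
split=> [a b|].
  rewrite -dE; split=> [/eqP|->]; last by rewrite mulr0.
  by rewrite mulf_eq0 gt_eqF//= => /eqP.
by split=> [a b|a b e]; [rewrite dC|rewrite -mulrDr ler_pM2l].
Qed.

Lemma scale_covers t p s r N : 0 < t ->
  covers (fun a b => t * d a b) s (oball (fun a b => t * d a b) p r) N <->
  covers d (s / t) (oball d p (r / t)) N.
Proof.
move=> t0; split=> -[f hf]; exists f => y; rewrite /oball/=.
  rewrite ltr_pdivlMr// mulrC => /hf[i iN iy]; exists i => //.
  by rewrite ltr_pdivlMr// mulrC.
rewrite mulrC -ltr_pdivlMr// => /hf[i iN iy]; exists i => //.
by rewrite mulrC -ltr_pdivlMr.
Qed.

End Scaling.

Section Tangents.
Context {R : realType} {X : Type} (d : X -> X -> R) (x : X).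
Hypothesis hd : is_metric d.

(** Covers are transferred in both directions at scale [1 / t k]. The gaps [rho' < rho] and [S < S']
    absorb the error [2 * eps] of the approximation. *)
Lemma tangent_covnum (T : Type) (dT : T -> T -> R) (q : T) (t : nat -> R) :
  is_metric dT ->
  (forall M : R, exists k0, forall k, (k0 <= k)%N -> M < t k) ->
  pGH_conv (fun k a b => t k * d a b) x dT q ->
  forall rho rho' S S' : R, 0 < rho' -> rho' < rho -> 0 < S -> S < S' ->
  exists k0, forall k, (k0 <= k)%N ->
    (covnum dT rho (oball dT q S) <=
      covnum d (rho' / t k) (oball d x (S' / t k)))%E /\
    (covnum d (rho / t k) (oball d x (S / t k)) <=
      covnum dT rho' (oball dT q S'))%E.
Proof.
move=> mT toy conv rho rho' S S' rho'0 rho'r S0 SS'.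
pose eps := Num.min ((rho - rho') / 2) ((S' - S) / 2).
have eps0 : 0 < eps by rewrite lt_min; apply/andP; split; lra.
have [e1 e2] : eps <= (rho - rho') / 2 /\ eps <= (S' - S) / 2.
  by rewrite !ge_min !lexx orbT.
have [|k1 hk1] := conv (S' + rho' + eps) eps _ eps0; first lra.
have [k2 hk2] := toy 0; exists (maxn k1 k2) => k.
rewrite geq_max => /andP[/hk1 ap /hk2 tk0].
have mD := scale_metric d _ tk0 hd.
split; apply: le_covnum => // N.
  move=> /(scale_covers d _ _ _ _ _ tk0);
  apply: (GH_covers_limit _ _ _ _ mD mT _ _ _ _ _ _ _ ap); lra.
move=> cN; apply/(scale_covers d _ _ _ _ _ tk0); move: cN.
by apply: (GH_covers_space _ _ _ _ mD mT _ _ _ _ _ _ _ ap); lra.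
Qed.

Lemma tangent_covnum_small (T : Type) (dT : T -> T -> R) (q : T)
    (rho rho' S S' e : R) : is_tangent d x dT q ->
  0 < rho' -> rho' < rho -> 0 < S -> S < S' -> 0 < e ->
  exists2 s : R, 0 < s < e &
    (covnum dT rho (oball dT q S) <= covnum d (rho' * s) (oball d x (S' * s)))%E /\
    (covnum d (rho * s) (oball d x (S * s)) <= covnum dT rho' (oball dT q S'))%E.
Proof.
move=> [mT [t [toy conv]]] rho'0 rho'r S0 SS' e0.
have [k1 hk1] := tangent_covnum _ _ _ _ mT toy conv _ _ _ _ rho'0 rho'r S0 SS'.
have [k2 hk2] := toy e^-1; exists (t (maxn k1 k2))^-1; last exact/hk1/leq_maxl.
have te := hk2 _ (leq_maxr k1 k2).
have t0 : 0 < t (maxn k1 k2) by apply: lt_trans te; rewrite invr_gt0.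
by rewrite invr_gt0 t0 invf_plt ?posrE.
Qed.

End Tangents.

(** * Limits inferior and superior at 0 *)

Section RightLimits.
Context {R : realType}.
Implicit Types (f g : R -> \bar R) (y : \bar R) (r e : R).

Lemma at0_rightP (V : set R) :
  (0^'+) V <-> exists2 e, 0 < e & forall r, 0 < r < e -> V r.
Proof.
split.
  rewrite /at_right /within/= => /nbhs_ballP[e /= e0 eV]; exists e => //.
  move=> r /andP[r0 re]; apply: eV => //.
  by rewrite /ball/= sub0r normrN gtr0_norm.
move=> [e e0 eV]; near=> r; apply: eV; apply/andP; split; near: r.
  exact: nbhs_right_gt.
exact: nbhs_right_lt.
Unshelve. all: by end_near. Qed.

Lemma limf_einf_gt f y : (y < limf_einf f 0^'+)%E ->
  exists2 e, 0 < e & forall r, 0 < r < e -> (y < f r)%E.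
Proof.
rewrite limf_einfE => /ereal_sup_gt[_ [V /at0_rightP[e e0 eV] <-] yV].
exists e => // r /eV Vr; apply: lt_le_trans yV _.
by apply: ereal_inf_lbound; exists r.
Qed.

Lemma limf_einf_lt f y e : (limf_einf f 0^'+ < y)%E -> 0 < e ->
  exists2 r, 0 < r < e & (f r < y)%E.
Proof.
move=> fy e0; have : (ereal_inf (f @` [set r | (0 < r < e)%R]) < y)%E.
  apply: le_lt_trans fy; rewrite limf_einfE; apply: ereal_sup_ubound.
  by exists [set r | (0 < r < e)%R] => //; apply/at0_rightP; exists e.
by move=> /ereal_inf_lt[_ [r re <-] ry]; exists r.
Qed.

Lemma le_limf_einf f y e : 0 < e -> (forall r, 0 < r < e -> (y <= f r)%E) ->
  (y <= limf_einf f 0^'+)%E.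
Proof.
move=> e0 yf; rewrite limf_einfE.
apply: (@le_trans _ _ (ereal_inf (f @` [set r | (0 < r < e)%R]))).
  by apply: le_ereal_inf_tmp => _ [r re <-]; exact: yf.
apply: ereal_sup_ubound; exists [set r | (0 < r < e)%R] => //.
by apply/at0_rightP; exists e.
Qed.

Lemma limf_esup_lt f y : (limf_esup f 0^'+ < y)%E ->
  exists2 e, 0 < e & forall r, 0 < r < e -> (f r < y)%E.
Proof.
rewrite limf_esupE => /ereal_inf_lt[_ [V /at0_rightP[e e0 eV] <-] yV].
exists e => // r /eV Vr; apply: le_lt_trans yV.
by apply: ereal_sup_ubound; exists r.
Qed.

Lemma limf_esup_gt f y e : (y < limf_esup f 0^'+)%E -> 0 < e ->
  exists2 r, 0 < r < e & (y < f r)%E.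
Proof.
move=> fy e0; have : (y < ereal_sup (f @` [set r | (0 < r < e)%R]))%E.
  apply: lt_le_trans fy _; rewrite limf_esupE; apply: ereal_inf_lbound.
  by exists [set r | (0 < r < e)%R] => //; apply/at0_rightP; exists e.
by move=> /ereal_sup_gt[_ [r re <-] ry]; exists r.
Qed.

Lemma limf_esup_le f y e : 0 < e -> (forall r, 0 < r < e -> (f r <= y)%E) ->
  (limf_esup f 0^'+ <= y)%E.
Proof.
move=> e0 yf; rewrite limf_esupE.
apply: (@le_trans _ _ (ereal_sup (f @` [set r | (0 < r < e)%R]))).
  apply: ereal_inf_lbound; exists [set r | (0 < r < e)%R] => //.
  by apply/at0_rightP; exists e.
by apply: ge_ereal_sup => _ [r re <-]; exact: yf.
Qed.

(** Reals separate extended reals, so dimensions can be compared through real bounds only, without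
    treating infinite values apart. *)
Lemma lee_EFin_lt (u v : \bar R) : (forall b : R, b%:E < u -> b%:E <= v)%E -> (u <= v)%E.
Proof.
move=> h; rewrite leNgt; apply/negP => vu.
have [b /andP[vb bu]] : exists b : R, (v < b%:E < u)%E.
  case: u v vu {h} => [u| |] [v| |]//= vu.
  - by exists ((u + v) / 2); rewrite !lte_fin in vu *; apply/andP; split; lra.
  - by exists (u - 1); rewrite lte_fin ltNyr/=; lra.
  - by exists (v + 1); rewrite lte_fin ltry/=; lra.
  - by exists 0; rewrite ltNyr ltry.
by have := h _ bu; rewrite leNgt vb.
Qed.

Lemma lee_lt_EFin (u v : \bar R) : (forall b : R, v < b%:E -> u <= b%:E)%E -> (u <= v)%E.
Proof.
move=> h; rewrite -leeN2; apply: lee_EFin_lt => b bv.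
by rewrite leeNr; apply: (h (- b)); rewrite EFinN lteNr.
Qed.

Lemma le_limf_einf_einf f g e : 0 < e -> (forall r, 0 < r < e -> (f r <= g r)%E) ->
  (limf_einf f 0^'+ <= limf_einf g 0^'+)%E.
Proof.
move=> e0 fg; apply: lee_EFin_lt => b /limf_einf_gt[e1 e10 bf].
apply: (@le_limf_einf _ _ (Num.min e e1)); first by rewrite lt_min e0.
move=> r; rewrite lt_min => /and3P[r0 re re1].
by rewrite ltW// (lt_le_trans (bf r _))// ?fg// r0.
Qed.

Lemma le_limf_esup_esup f g e : 0 < e -> (forall r, 0 < r < e -> (f r <= g r)%E) ->
  (limf_esup f 0^'+ <= limf_esup g 0^'+)%E.
Proof.
move=> e0 fg; apply: lee_lt_EFin => b /limf_esup_lt[e1 e10 bf].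
apply: (@limf_esup_le _ _ (Num.min e e1)); first by rewrite lt_min e0.
move=> r; rewrite lt_min => /and3P[r0 re re1].
by rewrite ltW// (le_lt_trans (fg r _))// ?bf// r0.
Qed.

Lemma limf_einf_le_esup f : (limf_einf f 0^'+ <= limf_esup f 0^'+)%E.
Proof.
apply: lee_EFin_lt => b /limf_einf_gt[e e0 bf].
apply: lee_lt_EFin => b' /limf_esup_lt[e1 e10 fb].
have r0 : 0 < Num.min e e1 / 2 by rewrite divr_gt0// lt_min e0.
have re : Num.min e e1 / 2 < Num.min e e1 by lra.
move: (re); rewrite lt_min => /andP[re0 re1].
apply/ltW/(@lt_trans _ _ (f (Num.min e e1 / 2))); [apply: bf|apply: fb].
  by rewrite r0.
by rewrite r0.
Qed.

End RightLimits.

(** * Logarithms of extended reals *)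

Section Elog.
Context {R : realType}.
Implicit Types (v : \bar R) (y L : R).

Lemma elog_ge v y : ((expR y)%:E <= v)%E -> (y%:E <= elog v)%E.
Proof.
case: v => [v| |]//=; last by move=> _; rewrite leey.
rewrite !lee_fin => yv; have v0 := lt_le_trans (expR_gt0 y) yv.
by rewrite -[y]expRK ler_ln ?posrE ?expR_gt0.
Qed.

(** The bound [1 <= v] excludes the nonpositive reals, on which [ln] is 0 by convention. *)
Lemma elog_le v y : (1 <= v)%E -> (v <= (expR y)%:E)%E -> (elog v <= y%:E)%E.
Proof.
case: v => [v| |]//=; rewrite !lee_fin => v1 yv.
have v0 := lt_le_trans ltr01 v1.
by rewrite -[y]expRK ler_ln ?posrE ?expR_gt0.
Qed.

Lemma elog_lt v y : (1 <= v)%E -> (elog v < y%:E)%E -> (v < (expR y)%:E)%E.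
Proof. by move=> v1; rewrite !ltNge; apply: contra; exact: elog_ge. Qed.

Lemma elog_gt v y : (1 <= v)%E -> (y%:E < elog v)%E -> ((expR y)%:E < v)%E.
Proof. by move=> v1; rewrite !ltNge; apply: contra; exact: elog_le. Qed.

End Elog.

(** * Box and tangential dimensions *)

Section BoxDimensions.
Context {R : realType} {T : Type} (dT : T -> T -> R) (q : T).

Lemma oball_center s : is_metric dT -> 0 < s -> oball dT q s q.
Proof. by move=> mT s0; rewrite /oball/=; have -> : dT q q = 0 by exact/mT.2.1. Qed.

Lemma box_ratio_ndecr r S S' : 0 < r < 1 -> S <= S' ->
  (box_ratio dT q S r <= box_ratio dT q S' r)%E.
Proof.
move=> /andP[r0 r1] SS; apply: lee_wpmul2r.
  by rewrite lee_fin invr_ge0 ln_ge0// invf_ge1// ltW.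
have : (covnum dT r (oball dT q S) <= covnum dT r (oball dT q S'))%E.
  apply: le_covnum => // N; apply: covers_le => // y.
  by rewrite /oball/= => /lt_le_trans; apply.
have [->|[M ->]] := covnum_nat dT q r (oball dT q S'); first by move=> _; rewrite leey.
have [->|[N ->]] := covnum_nat dT q r (oball dT q S); first by rewrite leye_eq.
rewrite !lee_fin ler_nat.
case: N => [|N] NM; last by rewrite ler_ln ?posrE ?ltr0n ?(leq_trans _ NM)// ler_nat.
by case: M NM => [|M] _; rewrite ln0// ln_ge0// ler1n.
Qed.

Lemma limf_einf_box_ratio_ndecr :
  {homo (fun S => limf_einf (fun r => box_ratio dT q S r) 0^'+) : S S' / S <= S' >->
    (S <= S')%E}.
Proof.
move=> S S' SS; apply: (@le_limf_einf_einf _ _ _ 1) => // r r1.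
exact: box_ratio_ndecr.
Qed.

Lemma limf_esup_box_ratio_ndecr :
  {homo (fun S => limf_esup (fun r => box_ratio dT q S r) 0^'+) : S S' / S <= S' >->
    (S <= S')%E}.
Proof.
move=> S S' SS; apply: (@le_limf_esup_esup _ _ _ 1) => // r r1.
exact: box_ratio_ndecr.
Qed.

(** The lower limits increase with the radius, so their limit exists and dominates the value at any
    single [S]. *)
Lemma box_dim_low_ge S v :
  (v <= limf_einf (fun r => box_ratio dT q S r) 0^'+)%E -> (v <= box_dim_low dT q)%E.
Proof.
move=> vS; apply: lime_ge.
  exact/nondecreasing_is_cvge/limf_einf_box_ratio_ndecr.
near=> S'; apply: le_trans vS _; apply: limf_einf_box_ratio_ndecr; near: S'.
exact/nbhs_pinfty_ge/num_real.
Unshelve. all: by end_near. Qed.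

Lemma box_dim_up_ge S v :
  (v <= limf_esup (fun r => box_ratio dT q S r) 0^'+)%E -> (v <= box_dim_up dT q)%E.
Proof.
move=> vS; apply: lime_ge.
  exact/nondecreasing_is_cvge/limf_esup_box_ratio_ndecr.
near=> S'; apply: le_trans vS _; apply: limf_esup_box_ratio_ndecr; near: S'.
exact/nbhs_pinfty_ge/num_real.
Unshelve. all: by end_near. Qed.

Lemma box_dim_low_le v :
  (forall S, 1 <= S -> (limf_einf (fun r => box_ratio dT q S r) 0^'+ <= v)%E) ->
  (box_dim_low dT q <= v)%E.
Proof.
move=> vS; apply: lime_le.
  exact/nondecreasing_is_cvge/limf_einf_box_ratio_ndecr.
near=> S; apply: vS; near: S; exact/nbhs_pinfty_ge/num_real.
Unshelve. all: by end_near. Qed.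

Lemma box_dim_up_le v :
  (forall S, 1 <= S -> (limf_esup (fun r => box_ratio dT q S r) 0^'+ <= v)%E) ->
  (box_dim_up dT q <= v)%E.
Proof.
move=> vS; apply: lime_le.
  exact/nondecreasing_is_cvge/limf_esup_box_ratio_ndecr.
near=> S; apply: vS; near: S; exact/nbhs_pinfty_ge/num_real.
Unshelve. all: by end_near. Qed.

Lemma box_dim_low_le_up : (box_dim_low dT q <= box_dim_up dT q)%E.
Proof.
apply: box_dim_low_le => S _; apply: (@box_dim_up_ge S); exact: limf_einf_le_esup.
Qed.

End BoxDimensions.

Section Growth.
Context {R : realType}.
Implicit Types (g : R -> \bar R) (al C e L r : R).

Lemma ln_inv_gt r L : 0 < r < expR (- L) -> L < ln r^-1.
Proof.
move=> /andP[r0 rL]; rewrite lnV ?posrE// ltrNr -[ltRHS]expRK.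
by rewrite ltr_ln ?posrE ?expR_gt0.
Qed.

(** The constant [C] disappears on division by [ln r^-1]: for [b < al] it is absorbed once
    [ln r^-1 > C / (al - b)]. *)
Lemma growth_einf_ge g al C e : 0 < e ->
  (forall r, 0 < r < e -> ((expR (al * ln r^-1 - C))%:E <= g r)%E) ->
  (al%:E <= limf_einf (fun r => elog (g r) * ((ln r^-1)^-1)%:E)%E 0^'+)%E.
Proof.
move=> e0 hg; apply: lee_EFin_lt => b; rewrite lte_fin => ba.
pose L0 := Num.max 0 (C / (al - b)).
apply: (@le_limf_einf _ _ _ (Num.min e (expR (- L0)))).
  by rewrite lt_min e0 expR_gt0.
move=> r; rewrite lt_min => /and3P[r0 re rL].
have := @ln_inv_gt r L0; rewrite r0 rL => /(_ isT).
rewrite gt_max => /andP[L1 L2]; rewrite lee_pdivlMr//.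
apply: le_trans (elog_ge _ _ (hg r _)); last by rewrite r0.
rewrite lee_fin; move: L2; rewrite ltr_pdivrMr; last by lra.
rewrite mulrBr; lra.
Qed.

Lemma growth_esup_le g al C e : 0 < e ->
  (forall r, 0 < r < e -> (1 <= g r <= (expR (al * ln r^-1 + C))%:E)%E) ->
  (limf_esup (fun r => elog (g r) * ((ln r^-1)^-1)%:E)%E 0^'+ <= al%:E)%E.
Proof.
move=> e0 hg; apply: lee_lt_EFin => b; rewrite lte_fin => ba.
pose L0 := Num.max 0 (C / (b - al)).
apply: (@limf_esup_le _ _ _ (Num.min e (expR (- L0)))).
  by rewrite lt_min e0 expR_gt0.
move=> r; rewrite lt_min => /and3P[r0 re rL].
have := @ln_inv_gt r L0; rewrite r0 rL => /(_ isT).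
rewrite gt_max => /andP[L1 L2]; rewrite lee_pdivrMr//.
have /andP[g1 gr] : (1 <= g r <= (expR (al * ln r^-1 + C))%:E)%E by rewrite hg// r0.
apply: le_trans (elog_le _ _ g1 gr) _.
rewrite lee_fin; move: L2; rewrite ltr_pdivrMr; last by lra.
rewrite mulrBr; lra.
Qed.

End Growth.

Section TangentialDimensions.
Context {R : realType} {X : Type} (d : X -> X -> R) (x : X).
Hypothesis hd : is_metric d.
Implicit Types (al e r lam : R).

Let cball_center r : 0 < r -> cball d x r x.
Proof. by move=> /ltW r0; rewrite /cball/=; have -> : d x x = 0 by exact/hd.2.1. Qed.

Let ln_inv_gt0 lam : 0 < lam < 1 -> 0 < ln lam^-1.
Proof. by move=> ?; apply: ln_inv_gt; rewrite oppr0 expR0. Qed.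

Lemma tang_dim_low_gt al : (al%:E < tang_dim_low d x)%E ->
  exists2 e, 0 < e & forall lam, 0 < lam < e -> exists2 e' : R, 0 < e' &
    forall r, 0 < r < e' ->
      ((expR (al * ln lam^-1))%:E <= covnum d (lam * r) (cball d x r))%E.
Proof.
(* The cap at 1 makes [ln lam^-1] positive, so that the quotient can be cleared. *)
move=> /limf_einf_gt[e e0 he]; exists (Num.min e 1); first by rewrite lt_min e0/=.
move=> lam; rewrite lt_min => /and3P[l0 le l1].
have [|e' e'0 he'] := limf_einf_gt _ _ (he lam _); first by rewrite l0.
exists e' => // r re'; have := he' r re'; have [r0 _] := andP re'.
rewrite /tang_ratio lte_pdivlMr ?ln_inv_gt0 ?l0// => /elog_gt H; apply/ltW/H.
exact/covnum_ge1/cball_center.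
Qed.

Lemma tang_dim_up_lt al : (tang_dim_up d x < al%:E)%E ->
  exists2 e, 0 < e & forall lam, 0 < lam < e -> exists2 e' : R, 0 < e' &
    forall r, 0 < r < e' ->
      (covnum d (lam * r) (cball d x r) <= (expR (al * ln lam^-1))%:E)%E.
Proof.
move=> /limf_esup_lt[e e0 he]; exists (Num.min e 1); first by rewrite lt_min e0/=.
move=> lam; rewrite lt_min => /and3P[l0 le l1].
have [|e' e'0 he'] := limf_esup_lt _ _ (he lam _); first by rewrite l0.
exists e' => // r re'; have := he' r re'; have [r0 _] := andP re'.
rewrite /tang_ratio lte_pdivrMr ?ln_inv_gt0 ?l0// => /elog_lt H; apply/ltW/H.
exact/covnum_ge1/cball_center.
Qed.

Lemma tang_dim_low_lt al e : (tang_dim_low d x < al%:E)%E -> 0 < e ->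
  exists2 lam, 0 < lam < e & forall e', 0 < e' -> exists2 r, 0 < r < e' &
    (covnum d (lam * r) (cball d x r) <= (expR (al * ln lam^-1))%:E)%E.
Proof.
move=> lt e0; have [|lam] := limf_einf_lt _ _ (Num.min e 1) lt.
  by rewrite lt_min e0/=.
rewrite lt_min => /and3P[l0 le l1] ltl; exists lam; first by rewrite l0.
move=> e' /(limf_einf_lt _ _ _ ltl)[r re' ltr]; exists r => //; move: ltr.
have [r0 _] := andP re'.
rewrite /tang_ratio lte_pdivrMr ?ln_inv_gt0 ?l0// => /elog_lt H; apply/ltW/H.
exact/covnum_ge1/cball_center.
Qed.

Lemma tang_dim_up_gt al e : (al%:E < tang_dim_up d x)%E -> 0 < e ->
  exists2 lam, 0 < lam < e & forall e', 0 < e' -> exists2 r, 0 < r < e' &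
    ((expR (al * ln lam^-1))%:E <= covnum d (lam * r) (cball d x r))%E.
Proof.
move=> lt e0; have [|lam] := limf_esup_gt _ _ (Num.min e 1) lt.
  by rewrite lt_min e0/=.
rewrite lt_min => /and3P[l0 le l1] ltl; exists lam; first by rewrite l0.
move=> e' /(limf_esup_gt _ _ _ ltl)[r re' ltr]; exists r => //; move: ltr.
have [r0 _] := andP re'.
rewrite /tang_ratio lte_pdivlMr ?ln_inv_gt0 ?l0// => /elog_gt H; apply/ltW/H.
exact/covnum_ge1/cball_center.
Qed.

End TangentialDimensions.

(* The index is a minimum of [u i - al * i] on [0, n]; the bound on the
   increments keeps it at distance at least [J] from [n]. *)
Lemma linear_growth_index {R : realType} (u : nat -> R) (n J : nat) (al C : R) :
  (J <= n)%N -> (forall i, (i < n)%N -> u i.+1 - u i <= C) ->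
  al * n%:R + (C - al) * J%:R < u n - u 0%N ->
  exists i, (i + J <= n)%N /\
    forall j, (j <= J)%N -> al * j%:R <= u (i + j)%N - u i.
Proof.
move=> Jn uC un; pose v i := u i - al * i%:R.
pose i := [arg min_(i < @ord0 n) v i]%O.
have vi k : (k <= n)%N -> v i <= v k.
  rewrite /i; case: arg_minP => // m _ /= vm kn.
  exact: (vm (Ordinal (kn : (k < n.+1)%N))).
have vC m k : (m + k <= n)%N -> v (m + k)%N - v m <= (C - al) * k%:R.
  elim: k => [|k IH] mk; first by rewrite addn0 subrr mulr0.
  rewrite addnS in mk *; have := IH (ltnW mk); have := uC _ mk.
  by rewrite /v -[(m + k).+1]addn1 -[k.+1]addn1 !natrD !mulrDr !mulr1; lra.
have iJ : (i + J <= n)%N.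
  have in_ : (i <= n)%N by rewrite -ltnS.
  (* With fewer than [J] steps left after [i], increments of at most [C - al] cannot raise [v] from
     [v i <= v 0] to [v n > v 0 + (C - al) * J]. If [C < al], the bound over all [n >= J] steps is
     already contradictory. *)
  rewrite leqNgt; apply/negP => nJ.
  have vin := vC i (n - i)%N; rewrite subnKC// leqnn in vin.
  have /= := vC 0%N n; rewrite add0n leqnn => /(_ isT) v0n.
  have vi0 := vi 0%N (leq0n _).
  have v0E : v 0%N = u 0%N by rewrite /v mulr0 subr0.
  have vnE : v n = u n - al * n%:R by [].
  have niJ : (n - i)%:R < J%:R :> R by rewrite ltr_nat ltn_subLR.
  have Jn' : J%:R <= n%:R :> R by rewrite ler_nat.
  have [Cal|Cal] := leP 0 (C - al).
    by have := ler_wpM2l Cal (ltW niJ); have := vin isT; lra.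
  by have := ler_wnM2l (ltW Cal) Jn'; lra.
exists i; split=> // j jJ; have := vi (i + j)%N.
rewrite (leq_trans _ iJ) ?leq_add2l// => /(_ isT).
by rewrite /v natrD mulrDr; lra.
Qed.

(** * Quasi-multiplicativity of covering numbers *)

(** [fine] turns an infinite covering number into 0, so the value is meaningful only where finite
    covers exist. *)
Definition ballcov {R : realType} {X : Type} (d : X -> X -> R) (x : X) (s r : R) :=
  fine (covnum d s (oball d x r)).

Section QuasiMultiplicativity.
Context {R : realType} {X : Type} (d : X -> X -> R) (x : X) (c a : R).
Hypotheses (hd : is_metric d) (hc : 1 <= c) (ha0 : 0 < a).
Hypothesis hdoub : forall r lam mu : R, 0 < r -> r <= a -> 0 < lam -> lam <= 1 ->
  0 < mu -> mu <= 1 -> forall y z : X, oball d x r y -> oball d x r z ->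
  (covnum d (lam * mu * r) (oball d y (lam * r))
     <= c%:E * covnum d (lam * mu * r) (oball d z (lam * r)))%E.
Hypothesis hfin : forall lam : R, 0 < lam ->
  (limf_esup (fun r => covnum d (lam * r) (cball d x r)) (0^'+) < +oo)%E.
Let B r := oball d x r.

Let Bx r : 0 < r -> B r x.
Proof. exact: oball_center. Qed.

(** This is [hdoub] with [lam = t / r] and [mu = s / t]. *)
Lemma covnum_homogeneous s t r y z : 0 < s -> s <= t -> t <= r -> r <= a ->
  B r y -> B r z ->
  (covnum d s (oball d y t) <= c%:E * covnum d s (oball d z t))%E.
Proof.
move=> s0 st tr ra yr zr; have t0 : 0 < t by lra.
have r0 : 0 < r by lra.
have tE : t / r * r = t by rewrite divfK ?gt_eqF.
have sE : t / r * (s / t) * r = s by rewrite mulrAC tE mulrC divfK ?gt_eqF.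
rewrite -sE -[in oball d y t]tE -[in oball d z t]tE.
by apply: hdoub; rewrite ?divr_gt0// ler_pdivrMr// mul1r.
Qed.

Lemma fin_covers lam : 0 < lam -> exists N e, 0 < e /\
  forall r, 0 < r < e -> covers d (lam * r) (B r) N.
Proof.
move=> l0; have [M hM] : exists M : R,
    (limf_esup (fun r => covnum d (lam * r) (cball d x r)) (0^'+) < M%:E)%E.
  have := hfin _ l0; case: limf_esup => [v| |]// _.
    by exists (v + 1); rewrite lte_fin ltrDl.
  by exists 0; rewrite ltNyr.
have [e e0 he] := limf_esup_lt _ _ hM.
exists (Num.truncn M).+1, e; split=> // r re.
have : covers d (lam * r) (cball d x r) (Num.truncn M).+1.
  apply/(covnum_le_natP _ x)/(le_trans (ltW (he r re))).
  by rewrite lee_fin ltW// truncnS_gt.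
by apply: covers_le => // y /ltW.
Qed.

(** Here [r0] does not depend on [s]. A ball of radius [r] is covered by [N1] balls of radius
    [r / 2]; by homogeneity each costs at most [c] times as much as the ball of radius [r / 2] at
    [x], so repeated halving reaches every scale. *)
Lemma fin_covers_all : exists2 r0, 0 < r0 & forall s r, 0 < s -> 0 < r < r0 ->
  exists N, covers d s (B r) N.
Proof.
have [|N1 [e [e0 he]]] := fin_covers (2^-1); first by rewrite invr_gt0.
(* The centres of the refined balls lie in the ball of radius [2 * r], so homogeneity asks for
   [2 * r <= a]. *)
pose r0 := Num.min e (a / 2).
have r00 : 0 < r0 by rewrite lt_min e0/= divr_gt0.
exists r0 => // s r s0 rr0.
have pow m : forall r, 0 < r < r0 -> exists N, covers d (2^-1 ^+ m * r) (B r) N.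
  elim: m => [|m IH] {rr0}{}r /andP[r1 rr0].
    exists 1%N, (fun=> x) => y; rewrite /B /oball/= => yr.
    by exists 0%N; rewrite // expr0 mul1r.
  move: (rr0); rewrite lt_min => /andP[re ra].
  have r2 : 0 < r / 2 by rewrite divr_gt0.
  have [Q cQ] := IH (r / 2) ltac:(apply/andP; split; lra).
  set s' := 2^-1 ^+ m.+1 * r.
  have sE : 2^-1 ^+ m * (r / 2) = s' by rewrite /s' exprSr; lra.
  have s'0 : 0 < s' by rewrite mulr_gt0// exprn_gt0 ?invr_gt0.
  have s'r : s' <= r / 2.
    by rewrite -sE ler_piMl ?(ltW r2)// exprn_ile1// ?invr_ge0// invf_le1// ler1n.
  exists (N1 * (Num.truncn (c * Q%:R)).+1)%N.
  apply: (covers_comp d s' (r / 2)); first by rewrite mulrC; apply: he; rewrite r1.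
  move=> y z zr yz; apply/(covnum_le_natP _ x).
  apply: (@le_trans _ _ (c%:E * covnum d s' (B (r / 2)))%E).
    apply: (@covnum_homogeneous _ _ (2 * r)) => //; [lra|lra| |].
      rewrite /B /oball/= in zr *.
      by have := hd.2.2.2 x z y; rewrite (hd.2.2.1 z); lra.
    by apply: Bx; lra.
  have /(covnum_le_natP _ x) cQ' := cQ; rewrite sE in cQ'.
  apply: le_trans (lee_wpmul2l _ cQ') _; first by rewrite lee_fin (le_trans ler01).
  by rewrite -EFinM lee_fin ltW// truncnS_gt.
have [r1 _] := andP rr0.
have [N cN] := pow (Num.truncn (r / s)) r rr0; exists N.
apply: covers_le cN => //.
have n_lt : r / s < 2 ^+ Num.truncn (r / s).
  rewrite -natrX; apply: lt_le_trans (truncnS_gt _) _.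
  by rewrite ler_nat ltn_expl.
rewrite exprVn mulrC ler_pdivrMr ?exprn_gt0//.
by rewrite mulrC -ler_pdivrMr// ltW.
Qed.

Let F := ballcov d x.

Let F_nat r0 : (forall s r, 0 < s -> 0 < r < r0 -> exists N, covers d s (B r) N) ->
  forall s r, 0 < s -> 0 < r < r0 ->
  exists N, [/\ covnum d s (B r) = N%:R%:E, F s r = N%:R & 1 <= F s r].
Proof.
move=> fin s r s0 rr; have [N cN] := fin s r s0 rr.
have [E|[M E]] := covnum_nat d x s (B r).
  by move/(covnum_le_natP _ x): cN; rewrite E leye_eq.
exists M; rewrite /F/ballcov E; split=> //; rewrite -lee_fin -[(fine _)%:E]/(M%:R%:E) -E.
by apply/covnum_ge1/Bx; case/andP: rr.
Qed.

Let F_le r0 : (forall s r, 0 < s -> 0 < r < r0 -> exists N, covers d s (B r) N) ->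
  forall s s' r r', 0 < s' -> s' <= s -> 0 < r -> r <= r' -> r' < r0 ->
  F s r <= F s' r'.
Proof.
move=> fin s s' r r' s'0 ss r1 rr r'0.
have [||N [E -> _]] := F_nat _ fin s r; [lra|by rewrite r1 (le_lt_trans rr)|].
have [|M [E' -> _]] := F_nat _ fin s' r' s'0; first by rewrite r'0 andbT; lra.
rewrite -lee_fin -E -E'; apply: le_covnum => // K; apply: covers_le => //.
by move=> y; rewrite /B /oball/= => /lt_le_trans; apply.
Qed.

(** Refine a minimal cover of [B r] by balls of radius [t]; each of them needs at most [c * F s t]
    balls of radius [s]. *)
Let F_submult r0 : r0 <= a / 2 ->
  (forall s r, 0 < s -> 0 < r < r0 -> exists N, covers d s (B r) N) ->
  forall s t r, 0 < s -> s <= t -> t <= r -> r < r0 ->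
  F s r <= c * (F t r * F s t).
Proof.
move=> r0a fin s t r s0 st tr rr0.
have t0 : 0 < t by lra.
have r1 : 0 < r < r0 by rewrite rr0 andbT; lra.
have t1 : 0 < t < r0 by rewrite t0; lra.
have [P [EP -> _]] := F_nat _ fin t r t0 r1.
have [Q [EQ -> _]] := F_nat _ fin s t s0 t1.
have [N [EN -> _]] := F_nat _ fin s r s0 r1.
have cQ0 : 0 <= c * Q%:R by rewrite mulr_ge0// (le_trans ler01).
suff : (N <= P * Num.truncn (c * Q%:R))%N.
  rewrite -(ler_nat R) natrM => /le_trans; apply.
  by rewrite mulrCA ler_wpM2l// truncn_le.
rewrite -(ler_nat R) -lee_fin -EN; apply/(covnum_le_natP _ x)/(covers_comp d s t).
  by apply/(covnum_le_natP _ x); rewrite EP.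
move=> y z zr yz.
apply/(covnum_le_natP _ x).
have hy : (covnum d s (oball d y t) <= c%:E * Q%:R%:E)%E.
  rewrite -EQ; case/andP: r1 => r1 _.
  apply: (@covnum_homogeneous s t (2 * r)) => //; [lra|lra| |apply: Bx; lra].
  rewrite /B /oball/= in zr *.
  by have := hd.2.2.2 x z y; rewrite (hd.2.2.1 z); lra.
have [E|[M EM]] := covnum_nat d x s (oball d y t); first by move: hy; rewrite E.
by move: hy; rewrite EM -EFinM !lee_fin ler_nat truncn_ge_nat.
Qed.

(** [B r] contains [F (4 * t) r] points that are [4 * t]-separated. The balls of radius [t] around
    them lie in [B (2 * r)], each needs at least [F s t / c] balls of radius [s], and no such small
    ball serves two of them. *)
Let F_supermult r0 : r0 <= a / 2 ->
  (forall s r, 0 < s -> 0 < r < r0 -> exists N, covers d s (B r) N) ->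
  forall s t r, 0 < s -> s <= t -> t <= r -> 2 * r < r0 ->
  F (4 * t) r * F s t <= c * F s (2 * r).
Proof.
move=> r0a fin s t r s0 st tr rr0.
have t0 : 0 < t by lra.
have r1 : 0 < r by lra.
have [||P [EP -> _]] := F_nat _ fin (4 * t) r; [lra|lra|].
have [|N [EN -> _]] := F_nat _ fin s (2 * r) s0; first lra.
have [|K [EK FK _]] := F_nat _ fin s t s0; first lra.
have [p [pB psep]] : exists p : nat -> X, (forall i, (i < P)%N -> B r (p i)) /\
    (forall i j, (i < j < P)%N -> 4 * t <= d (p i) (p j)).
  apply: separated_points => // M MP /(covnum_le_natP _ x).
  by rewrite EP lee_fin ler_nat leqNgt MP.
(* The least such [Q] is an integer substitute for [F s t / c]. *)
have exQ : exists Q : nat, F s t <= c * Q%:R.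
  by exists K; rewrite FK ler_peMl.
pose Q := ex_minn exQ.
have [FQ minQ] : F s t <= c * Q%:R /\ forall M : nat, F s t <= c * M%:R -> (Q <= M)%N.
  by rewrite /Q; case: ex_minnP.
have PQ : (P * Q <= N)%N.
  apply: (separated_covers d hd p s t (B (2 * r)) P Q N st psep).
  - move=> i iP y; have := pB i iP; rewrite /B /oball/= => xi iy.
    by have := hd.2.2.2 x (p i) y; lra.
  - move=> i M iP /(covnum_le_natP _ x) iM; apply: minQ.
    rewrite -lee_fin FK -EK EFinM.
    apply: le_trans (_ : c%:E * covnum d s (oball d (p i) t) <= _)%E; last first.
      by apply: lee_wpmul2l iM; rewrite lee_fin (le_trans ler01).
    by apply: (@covnum_homogeneous s t r) => //; [lra|exact: Bx|exact: pB].
  - by apply/(covnum_le_natP _ x); rewrite EN.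
have c0 : 0 <= c by exact: le_trans hc.
have PQ' : P%:R * Q%:R <= N%:R :> R by rewrite -natrM ler_nat.
apply: le_trans (ler_wpM2l (ler0n _ P) FQ) _.
by rewrite mulrCA ler_wpM2l.
Qed.

(** The factors 4 and 2 in [F_supermult] are removed by submultiplicativity and the bounds [M4] on
    [F t (4 * t)] and [M2] on [F r (2 * r)]. *)
Lemma ballcov_quasi_multiplicative : exists r1 K : R, [/\ 0 < r1 /\ 1 <= K,
  forall s r, 0 < s -> 0 < r < r1 ->
    covnum d s (oball d x r) = (F s r)%:E /\ 1 <= F s r,
  forall s s' r r', 0 < s' -> s' <= s -> 0 < r -> r <= r' -> r' < r1 ->
    F s r <= F s' r',
  forall s t r, 0 < s -> s <= t -> t <= r -> r < r1 ->
    F s r <= K * (F t r * F s t) /\ F t r * F s t <= K * F s r &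
  forall A, 0 < A -> exists2 C, 1 <= C & exists2 e, 0 < e &
    forall s, 0 < s < e -> F s (A * s) <= C].
Proof.
have [r0' r0'0 fin'] := fin_covers_all.
pose r0 := Num.min r0' (a / 2).
have r00 : 0 < r0 by rewrite lt_min r0'0 divr_gt0.
have r0a : r0 <= a / 2 by rewrite ge_min lexx orbT.
have fin s r : 0 < s -> 0 < r < r0 -> exists N, covers d s (B r) N.
  move=> s0 /andP[r1 rr]; apply: fin' => //; rewrite r1/=.
  by apply: lt_le_trans rr _; rewrite ge_min lexx.
have nat_ := F_nat _ fin; have mono := F_le _ fin.
have sub := F_submult _ r0a fin; have super := F_supermult _ r0a fin.
have Fbd A : 0 < A -> exists2 C, 1 <= C & exists2 e, 0 < e &
    forall s, 0 < s < e -> F s (A * s) <= C.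
  move=> A0; have [|N [e [e0 he]]] := fin_covers A^-1; first by rewrite invr_gt0.
  exists N.+1%:R; first by rewrite ler1n.
  exists (Num.min e r0 / A) => [|s /andP[s0]]; first by rewrite divr_gt0// lt_min e0.
  rewrite ltr_pdivlMr// mulrC lt_min => /andP[se sr0].
  have As0 : 0 < A * s by rewrite mulr_gt0.
  have [|M [EM -> _]] := nat_ s (A * s) s0; first by rewrite As0.
  have := he (A * s); rewrite As0 se mulKf ?gt_eqF// => /(_ isT)/(covnum_le_natP _ x).
  by rewrite EM lee_fin => /le_trans; apply; rewrite ler_nat.
have [M2 M21 [e2 e20 he2]] := Fbd 2 ltac:(by []).
have [M4 M41 [e4 e40 he4]] := Fbd 4 ltac:(by []).
pose r1 := Num.min (r0 / 4) (Num.min e2 e4).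
have r10 : 0 < r1 by rewrite !lt_min e20 e40 !andbT divr_gt0.
(* One factor [c] comes from [F_supermult], and one from each of the two uses of [F_submult] in
   [step1] and [step2]. *)
pose K := c ^+ 3 * M2 * M4.
have c0 : 0 < c by exact: lt_le_trans hc.
have r1r0 : r1 < r0 by apply: (@le_lt_trans _ _ (r0 / 4)); [rewrite ge_min lexx|lra].
have cK : c <= K.
  rewrite /K -mulrA exprS -mulrA ler_peMr ?(ltW c0)//.
  by rewrite mulr_ege1// ?exprn_ege1// mulr_ege1.
have FE s r : 0 < s -> 0 < r < r1 -> covnum d s (B r) = (F s r)%:E /\ 1 <= F s r.
  move=> s0 /andP[r'0]; rewrite lt_min => /andP[rr0 _].
  have [|N [EN FN F1]] := nat_ s r s0; first lra.
  by rewrite EN FN -FN.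
have sup s t r : 0 < s -> s <= t -> t <= r -> r < r1 -> F t r * F s t <= K * F s r.
  move=> s0 st tr; rewrite !lt_min => /and3P[rr0 re2 re4].
  have t0 : 0 < t by lra.
  have r'0 : 0 < r by lra.
  have F1 u v : 0 < u -> 0 < v < r0 -> 1 <= F u v.
    by move=> u0 v0; have [N []] := nat_ u v u0 v0.
  have Fst1 : 1 <= F s t by apply: F1 => //; lra.
  have step1 : F t r <= c * M4 * F (4 * t) r.
    have F4r1 : 1 <= F (4 * t) r by apply: F1; lra.
    have t4 : F t (4 * t) <= M4 by apply: he4; rewrite t0; lra.
    (* If [4 * t > r], then [F t r] itself is at most [M4]. *)
    have [t4r|t4r] := leP (4 * t) r.
      apply: le_trans (sub t (4 * t) r t0 _ t4r _) _; [lra|lra|].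
      rewrite -mulrA ler_pM2l// mulrC ler_wpM2r//; lra.
    apply: (@le_trans _ _ M4); first by apply: le_trans (mono _ _ _ _ _ _ _ _ _) t4; lra.
    rewrite mulrAC ler_peMl//; first lra.
    by rewrite mulr_ege1.
  have step2 : F s (2 * r) <= c * M2 * F s r.
    apply: le_trans (sub s r (2 * r) s0 _ _ _) _; [lra|lra|lra|].
    rewrite -mulrA ler_pM2l// ler_wpM2r//; first by have := F1 s r s0; lra.
    by apply: he2; rewrite r'0.
  have step3 := super s t r s0 st tr ltac:(lra).
  have cM4 : 0 <= c * M4 by rewrite mulr_ge0; lra.
  apply: (@le_trans _ _ (c * M4 * (F (4 * t) r * F s t))).
    by rewrite mulrA ler_wpM2r//; lra.
  apply: (@le_trans _ _ (c * M4 * (c * (c * M2 * F s r)))).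
    by apply: ler_wpM2l => //; apply: le_trans step3 _; rewrite ler_pM2l.
  by rewrite le_eqVlt; apply/orP; left; apply/eqP; rewrite /K; ring.
exists r1, K; split=> //.
- by split=> //; exact: le_trans cK.
- move=> s s' r r' s'0 ss r'1 rr rr1; apply: mono => //.
  exact: lt_trans r1r0.
- move=> s t r s0 st tr rr1; split; last exact: sup.
  apply: le_trans (sub s t r s0 st tr _) _; first exact: lt_trans r1r0.
  have rr0 : r < r0 by exact: lt_trans r1r0.
  have [||N [_ -> _]] := nat_ t r; [lra|lra|].
  have [||M [_ -> _]] := nat_ s t; [lra|lra|].
  by rewrite ler_wpM2r.
Qed.

End QuasiMultiplicativity.

(** * Quasi-additivity of logarithmic covering numbers *)

Definition logcov {R : realType} {X : Type} (d : X -> X -> R) (x : X) (s r : R) :=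
  ln (ballcov d x s r).

Section LogCovering.
Context {R : realType} {X : Type} (d : X -> X -> R) (x : X) (c a : R).
Hypotheses (hd : is_metric d) (hc : 1 <= c) (ha0 : 0 < a).
Hypothesis hdoub : forall r lam mu : R, 0 < r -> r <= a -> 0 < lam -> lam <= 1 ->
  0 < mu -> mu <= 1 -> forall y z : X, oball d x r y -> oball d x r z ->
  (covnum d (lam * mu * r) (oball d y (lam * r))
     <= c%:E * covnum d (lam * mu * r) (oball d z (lam * r)))%E.
Hypothesis hfin : forall lam : R, 0 < lam ->
  (limf_esup (fun r => covnum d (lam * r) (cball d x r)) (0^'+) < +oo)%E.
Let f := logcov d x.

Lemma logcov_quasi_additive : exists r1 kap : R, [/\ 0 < r1,
  forall s r, 0 < s -> 0 < r < r1 ->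
    covnum d s (oball d x r) = (expR (f s r))%:E /\ 0 <= f s r,
  forall s s' r r', 0 < s' -> s' <= s -> 0 < r -> r <= r' -> r' < r1 ->
    f s r <= f s' r',
  forall s t r, 0 < s -> s <= t -> t <= r -> r < r1 ->
    f s r <= f t r + f s t + kap /\ f t r + f s t <= f s r + kap &
  forall A, 0 < A -> exists C e, 0 < e /\
    forall s, 0 < s < e -> f s (A * s) <= C].
Proof.
have [r1 [K [[r10 K1] FE mono quasi Fbd]]] :=
  ballcov_quasi_multiplicative d x c a hd hc ha0 hdoub hfin.
have FE1 s r : 0 < s -> 0 < r -> r < r1 -> 1 <= ballcov d x s r.
  by move=> s0 r'0 rr; have [|] := FE s r s0; rewrite ?r'0.
exists r1, (ln K); split=> //.
- move=> s r s0 rr; have [-> F1] := FE s r s0 rr.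
  by rewrite /f/logcov lnK ?ln_ge0// posrE (lt_le_trans ltr01).
- move=> s s' r r' s'0 ss r'1 rr rr1.
  have F1 : 1 <= ballcov d x s r by apply: FE1; lra.
  have F1' : 1 <= ballcov d x s' r' by apply: FE1; lra.
  by rewrite /f/logcov ler_ln ?posrE ?mono//; lra.
- move=> s t r s0 st tr rr1.
  have F1 : 1 <= ballcov d x s r by apply: FE1; lra.
  have F2 : 1 <= ballcov d x t r by apply: FE1; lra.
  have F3 : 1 <= ballcov d x s t by apply: FE1; lra.
  have [q1 q2] := quasi s t r s0 st tr rr1; rewrite /f/logcov.
  move: (ballcov d x s r) (ballcov d x t r) (ballcov d x s t) F1 F2 F3 q1 q2.
  move=> u v w u1 v1 w1 q1 q2.
  have [K0 u0 v0 w0] : [/\ 0 < K, 0 < u, 0 < v & 0 < w] by split; lra.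
  have vw : 0 < v * w by rewrite mulr_gt0.
  rewrite -(lnM v0 w0) -(lnM vw K0) -(lnM u0 K0).
  split; rewrite ler_ln ?posrE; rewrite ?[_ * K]mulrC //; exact: mulr_gt0.
- move=> A A0; have [C C1 [e e0 he]] := Fbd A A0.
  exists (ln C), (Num.min e (r1 / A)); split=> [|s].
    by rewrite lt_min e0 divr_gt0.
  rewrite lt_min ltr_pdivlMr// => /and3P[s0 se sA].
  have F1 : 1 <= ballcov d x s (A * s) by rewrite FE1 ?mulr_gt0// mulrC.
  rewrite /f/logcov ler_ln ?posrE; [|lra|lra].
  by apply: he; rewrite s0.
Qed.

End LogCovering.

(** * Tangent sets *)

Section TangentExtraction.
Context {R : realType} {X : Type} (d : X -> X -> R) (x : X) (s : nat -> R).
Hypothesis hd : is_metric d.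
Hypothesis hfin : forall lam : R, 0 < lam -> exists N e, 0 < e /\
  forall r, 0 < r < e -> covers d (lam * r) (oball d x r) N.
Hypothesis s_gt0 : forall k, 0 < s k.
Hypothesis s_small : forall k, s k < k.+1%:R^-1.

Let s_to0 e : 0 < e -> exists k0, forall k, (k0 <= k)%N -> s k < e.
Proof.
move=> e0; exists (Num.truncn e^-1) => k kk; apply: lt_trans (s_small k) _.
rewrite invf_plt ?posrE ?ltr0n//; apply: lt_le_trans (truncnS_gt _) _.
by rewrite ler_nat ltnS.
Qed.

(** The covers with [lam = eps / r] have a size independent of the scale, which is the uniform total
    boundedness needed to extract a limit. *)
Lemma tangent_along_subsequence : exists (T : Type) (dT : T -> T -> R) (q : T) phi,
  [/\ is_metric dT, forall m, (m <= phi m)%N,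
    forall M : R, exists k0, forall k, (k0 <= k)%N -> M < (s (phi k))^-1 &
    pGH_conv (fun m a b => (s (phi m))^-1 * d a b) x dT q].
Proof.
have si0 k : 0 < (s k)^-1 by rewrite invr_gt0.
have [||T [dT [q [mT [phi [mphi conv]]]]]] :=
    GH_subsequence (fun k a b => (s k)^-1 * d a b) x.
- by move=> k; exact: scale_metric.
- move=> r eps r0 eps0; have [|N [e [e0 he]]] := hfin (eps / r).
    by rewrite divr_gt0.
  have [|k1 hk1] := s_to0 (e / r); first by rewrite divr_gt0.
  exists N, k1 => k /hk1 ske; apply/(scale_covers d _ _ _ _ _ (si0 k)); rewrite !invrK.
  have rs : 0 < r * s k < e by rewrite mulr_gt0//= mulrC -ltr_pdivlMr.
  by have := he _ rs; rewrite mulrA divfK ?gt_eqF.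
exists T, dT, q, phi; split=> // M.
have M0 : 0 < Num.max 1 M by rewrite lt_max ltr01.
have [|k0 hk0] := s_to0 (Num.max 1 M)^-1; first by rewrite invr_gt0.
exists k0 => k k0k; have := hk0 _ (leq_trans k0k (mphi k)).
rewrite -[ltLHS]invrK ltf_pV2 ?posrE// => /(le_lt_trans _); apply.
by rewrite le_max lexx orbT.
Qed.

End TangentExtraction.

Section TangentDimensions.
Context {R : realType} {X : Type} (d : X -> X -> R) (x : X).
Hypothesis hd : is_metric d.
Context (T : Type) (dT : T -> T -> R) (q : T).
Hypothesis tT : is_tangent d x dT q.

(** A single ball of [T], of radius 2, suffices: its covering number at [r] dominates that of the
    ball of radius [3 / 2 * s] in [X] at [2 * r * s], and this ball contains the closed ball of
    radius [s]. The factor 2 costs only the constant [al * ln 2]. *)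
Lemma tang_dim_low_le_box_dim_low : (tang_dim_low d x <= box_dim_low dT q)%E.
Proof.
apply: lee_EFin_lt => al /(tang_dim_low_gt d x hd)[e e0 he].
apply: (box_dim_low_ge _ _ 2).
apply: (growth_einf_ge _ _ (al * ln 2) (e / 2)) => [|r /andP[r0 re]].
  by rewrite divr_gt0.
have [|e' e'0 he'] := he (2 * r); first by lra.
have [|||||s /andP[s0 se] [_ le]] :=
  tangent_covnum_small d x hd T dT q (2 * r) r (3 / 2) 2 e' tT; [lra|lra|lra|lra|by []|].
have := he' s; rewrite s0 se => /(_ isT) H.
apply: (@le_trans _ _ (covnum d (2 * r * s) (cball d x s))); last first.
  apply: le_trans le; apply: le_covnum => // N; apply: covers_le => // y.
  by rewrite /cball/oball/= => /le_lt_trans; apply; lra.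
apply: le_trans H; rewrite lee_fin ler_expR.
by rewrite !lnV ?posrE ?mulr_gt0// lnM ?posrE// !mulrN mulrDr; lra.
Qed.

(** All radii [S] must be treated. Covers of the ball of radius [2 * S * s] in [X] by balls of
    radius [r / 2 * s] correspond to [lam = r / (4 * S)], and the constant [al * ln (4 * S)] does
    not depend on [r]. *)
Lemma box_dim_up_le_tang_dim_up : (box_dim_up dT q <= tang_dim_up d x)%E.
Proof.
apply: lee_lt_EFin => al /(tang_dim_up_lt d x hd)[e e0 he].
apply: (box_dim_up_le _ _) => S S1.
apply: (growth_esup_le _ _ (al * ln (4 * S)) (e * S)) => [|r /andP[r0 re]].
  by rewrite mulr_gt0//; lra.
have S0 : 0 < S by lra.
have mT := tT.1.
apply/andP; split; first by apply: covnum_ge1; apply: oball_center => //.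
have rS : 0 < r / (4 * S) < e.
  by rewrite divr_gt0//= ?ltr_pdivrMr; nra.
have [e' e'0 he'] := he (r / (4 * S)) rS.
have [|||||s /andP[s0 se] [le _]] :=
  tangent_covnum_small d x hd T dT q r (r / 2) S (2 * S) (e' / (2 * S)) tT;
  [lra|lra|lra|lra|by rewrite divr_gt0//; lra|].
have := he' (2 * S * s); rewrite ltr_pdivlMr in se; last by lra.
rewrite !mulr_gt0//= mulrC se => /(_ isT) H.
apply: le_trans le _.
apply: (@le_trans _ _ (covnum d (r / (4 * S) * (2 * S * s)) (cball d x (2 * S * s)))).
  apply: le_covnum => // N; apply: covers_le => //; last by move=> y /ltW.
  by rewrite le_eqVlt; apply/orP; left; apply/eqP; field; lra.
rewrite mulrC in H; apply: le_trans H _; rewrite lee_fin ler_expR invf_div.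
by rewrite [ln (4 * S / r)]lnM ?posrE ?invr_gt0 ?mulr_gt0// mulrDr; lra.
Qed.

End TangentDimensions.

(** * Scales of extremal growth *)

Section GoodScales.
Context {R : realType} {X : Type} (d : X -> X -> R) (x : X) (r1 kap : R).
Let f := logcov d x.
Hypotheses (hd : is_metric d) (r10 : 0 < r1).
Hypothesis fE : forall s r, 0 < s -> 0 < r < r1 ->
  covnum d s (oball d x r) = (expR (f s r))%:E /\ 0 <= f s r.
Hypothesis f_mono : forall s s' r r', 0 < s' -> s' <= s -> 0 < r -> r <= r' ->
  r' < r1 -> f s r <= f s' r'.
Hypothesis f_quasi : forall s t r, 0 < s -> s <= t -> t <= r -> r < r1 ->
  f s r <= f t r + f s t + kap /\ f t r + f s t <= f s r + kap.
Hypothesis f_bnd : forall A, 0 < A -> exists C e, 0 < e /\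
  forall s, 0 < s < e -> f s (A * s) <= C.

Let expNS k (s : R) : expR (- k.+1%:R) * s = expR (- 1) * (expR (- k%:R) * s).
Proof. by rewrite mulrA -expRD -[k.+1]addn1 natrD; congr (expR _ * _); ring. Qed.

Let expND i j (s : R) :
  expR (- (i + j)%:R) * s = expR (- j%:R) * (expR (- i%:R) * s).
Proof. by rewrite mulrA -expRD natrD; congr (expR _ * _); ring. Qed.

Let expN_le k (s : R) : 0 < s -> 0 < expR (- k%:R) * s <= s.
Proof.
by move=> s0; rewrite mulr_gt0 ?expR_gt0//= ler_piMl ?(ltW s0).
Qed.

(** [linear_growth_index] is applied with slope [- be] to the opposites of the logarithmic covering
    numbers, whose increments are nonpositive by monotonicity. Quasi-additivity then changes the
    outer radius from [r] to [s] at cost [kap]. *)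
Lemma good_scales_low (be : R) : (tang_dim_low d x < be%:E)%E ->
  exists C, forall (J : nat) (e : R), 0 < e -> exists2 s, 0 < s < e &
    forall j, (j <= J)%N -> f (expR (- j%:R) * s) s <= be * j%:R + C.
Proof.
move=> low; exists kap => J e e0.
have [al lowal] : exists2 al : R, (tang_dim_low d x < al%:E)%E & al < be.
  case: tang_dim_low low => [v| |]//; rewrite ?lte_fin => vb.
    by exists ((v + be) / 2); rewrite ?lte_fin; lra.
  by exists (be - 1); rewrite ?ltNyr//; lra.
move=> albe.
(* Chosen so that [n], the integer part of [L > L0], is at least [J] and [(be - al) * n] exceeds the
   losses: [|al|] from rounding and [|be| * J] from the last [J] levels. *)
pose L0 := (`|be| * J%:R + `|al|) / (be - al) + J%:R + 2.
have [lam /andP[l0 lL]] := tang_dim_low_lt d x hd al _ lowal (expR_gt0 (- L0)).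
move=> /(_ (Num.min e r1)); rewrite lt_min e0 r10 => /(_ isT)[r /andP[r0]].
rewrite lt_min => /andP[re rr1] cov.
have L0L : L0 < ln lam^-1 by apply: ln_inv_gt; rewrite l0.
have D0 : 0 <= (`|be| * J%:R + `|al|) / (be - al).
  by rewrite divr_ge0 ?subr_ge0 ?(ltW albe)// addr_ge0 ?mulr_ge0.
have J0 : 0 <= J%:R :> R by [].
set L := ln lam^-1 in cov L0L.
have Lpos : 0 <= L by rewrite /L0 in L0L; lra.
pose n := Num.truncn L; have /andP[nL Ln] := truncn_itv Lpos; rewrite -/n in nL Ln.
rewrite -natr1 in Ln.
have lamn : lam * r <= expR (- n%:R) * r.
  rewrite ler_pM2r// -[lam]invrK -[lam^-1]lnK ?posrE ?invr_gt0// -expRN ler_expR.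
  by rewrite lerN2.
have lr0 : 0 < lam * r by rewrite mulr_gt0.
have fn : f (expR (- n%:R) * r) r <= al * n%:R + `|al|.
  have fl : f (lam * r) r <= al * L.
    have [E _] := fE (lam * r) r lr0 ltac:(by rewrite r0).
    rewrite -ler_expR -lee_fin -E; apply: le_trans cov.
    by apply: le_covnum => // N; apply: covers_le => // y /ltW.
  apply: le_trans (f_mono _ _ _ _ lr0 lamn r0 (lexx r) rr1) (le_trans fl _).
  have [al0|al0] := ger0P al; first by nra.
  by nra.
have Jn : (J <= n)%N.
  rewrite -(ler_nat R); rewrite /L0 in L0L; lra.
pose u i := - f (expR (- i%:R) * r) r.
have u0 : u 0%N <= 0.
  by rewrite /u oppr0 expR0 mul1r oppr_le0; have [] := fE r r r0 ltac:(by rewrite r0).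
have [||i [iJ hi]] := linear_growth_index u n J (- be) 0 Jn.
- move=> i _; rewrite /u opprK addrC subr_le0.
  have /andP[h1 h2] := expN_le i r r0.
  have /andP[h3 h4] := expN_le 1 _ h1; rewrite -expNS in h3 h4.
  by apply: f_mono.
- have key : `|be| * J%:R + `|al| < (be - al) * n%:R.
    rewrite [ltRHS]mulrC -ltr_pdivrMr ?subr_gt0//; rewrite /L0 in L0L; lra.
  have bJ : be * J%:R <= `|be| * J%:R by rewrite ler_wpM2r// ler_norm.
  have un : - (al * n%:R + `|al|) <= u n by rewrite /u lerN2.
  by rewrite mulrBl in key; rewrite sub0r opprK mulNr; lra.
have /andP[s0 sr] := expN_le i r r0.
exists (expR (- i%:R) * r); first by rewrite s0 (le_lt_trans sr).
move=> j jJ; have := hi j jJ; rewrite /u opprK expND.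
have /andP[h1 h2] := expN_le j _ s0.
have [_] := f_quasi _ _ _ h1 h2 sr rr1; rewrite mulNr; lra.
Qed.

(** The increments are now nonnegative; they are bounded by [C4 + kap], where [C4] bounds the cost
    of refining by the ratio [expR 1]. *)
Lemma good_scales_up (be : R) : (be%:E < tang_dim_up d x)%E ->
  exists C, forall (J : nat) (e : R), 0 < e -> exists2 s, 0 < s < e &
    forall j, (j <= J)%N -> be * j%:R - C <= f (expR (- j%:R) * s) s.
Proof.
move=> up; exists kap => J e e0.
have [al upal] : exists2 al : R, (al%:E < tang_dim_up d x)%E & be < al.
  case: tang_dim_up up => [v| |]//; rewrite ?lte_fin => vb.
    by exists ((v + be) / 2); rewrite ?lte_fin; lra.
  by exists (be + 1); rewrite ?ltry//; lra.
move=> beal.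
have [C1 [e1 [e10 fC1]]] := f_bnd 1 ltr01.
have [C2 [e2 [e20 fC2]]] := f_bnd 2 (ltr0n _ 2).
have [C4 [e4 [e40 fC4]]] := f_bnd (expR 1) (expR_gt0 1).
(* [D] collects the losses: rounding, passage from radius [2 * r] to [r], the initial value, and the
   last [J] levels. *)
pose D := `|al| + kap + C2 + C1 + `|(C4 + kap - be) * J%:R|.
pose L0 := `|D| / (al - be) + J%:R + 1.
have [lam /andP[l0 lL]] := tang_dim_up_gt d x hd al _ upal (expR_gt0 (- L0)).
move=> /(_ (Num.min (Num.min e (r1 / 2)) (Num.min e1 (Num.min e2 e4)))).
rewrite !lt_min e0 e10 e20 e40 divr_gt0//= => /(_ isT)[r /andP[r0]].
rewrite !lt_min => /andP[/andP[re rr2] /and3P[re1 re2 re4]] cov.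
have rr1 : r < r1 by lra.
have L0L : L0 < ln lam^-1 by apply: ln_inv_gt; rewrite l0.
have D0 : 0 <= `|D| / (al - be) by rewrite divr_ge0//; lra.
have J0 : 0 <= J%:R :> R by [].
set L := ln lam^-1 in cov L0L.
have Lpos : 0 <= L by rewrite /L0 in L0L; lra.
pose n := (Num.truncn L).+1; have /andP[nL Ln] := truncn_itv Lpos; rewrite -/n in Ln.
have {}nL : n%:R <= L + 1 by rewrite /n -natr1 lerD2r.
have lamn : expR (- n%:R) * r <= lam * r.
  rewrite ler_pM2r// -[lam]invrK -[lam^-1]lnK ?posrE ?invr_gt0// -expRN ler_expR.
  by rewrite lerN2 ltW.
have lr0 : 0 < lam * r by rewrite mulr_gt0.
have lr : lam * r <= r.
  rewrite ler_piMl ?(ltW r0)//; apply: ltW (lt_le_trans lL _).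
  by rewrite -[leRHS]expR0 ler_expR oppr_le0 /L0; lra.
have /andP[nr0 nr] := expN_le n r r0.
have fn : al * n%:R - `|al| - kap - C2 <= f (expR (- n%:R) * r) r.
  (* The closed ball of radius [r] is only contained in a larger open ball; returning from [2 * r]
     to [r] costs [kap + C2]. *)
  have fl : al * L <= f (lam * r) (2 * r).
    have [E _] := fE (lam * r) (2 * r) lr0 ltac:(lra).
    rewrite -ler_expR -lee_fin -E; apply: le_trans cov _.
    apply: le_covnum => // N; apply: covers_le => // y.
    by rewrite /cball/oball/= => /le_lt_trans; apply; lra.
  have [q _] := f_quasi _ _ (2 * r) lr0 lr ltac:(lra) ltac:(lra).
  have q2 : f r (2 * r) <= C2 by apply: fC2; rewrite r0.
  have q3 := f_mono _ _ _ _ nr0 lamn r0 (lexx r) rr1.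
  have q4 : al * n%:R - `|al| <= al * L by have [al0|al0] := ger0P al; nra.
  lra.
have Jn : (J <= n)%N.
  rewrite -(ler_nat R); rewrite /L0 in L0L; lra.
pose u i := f (expR (- i%:R) * r) r.
have u0 : u 0%N <= C1.
  by rewrite /u oppr0 expR0 mul1r -{2}[r]mul1r; apply: fC1; rewrite r0.
have [||i [iJ hi]] := linear_growth_index u n J be (C4 + kap) Jn.
- move=> i _; rewrite /u expNS.
  have /andP[h1 h2] := expN_le i r r0.
  have /andP[h3 h4] := expN_le 1 _ h1.
  have [q _] := f_quasi _ _ _ h3 h4 h2 rr1.
  suff : f (expR (- 1) * (expR (- i%:R) * r)) (expR (- i%:R) * r) <= C4 by lra.
  rewrite -[X in f _ X](_ : expR 1 * (expR (- 1) * (expR (- i%:R) * r)) = _).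
    by apply: fC4; rewrite h3; lra.
  by rewrite mulrA -expRD subrr expR0 mul1r.
- have key : `|D| < (al - be) * n%:R.
    rewrite [ltRHS]mulrC -ltr_pdivrMr ?subr_gt0//; rewrite /L0 in L0L; lra.
  have DD : D <= `|D| by rewrite ler_norm.
  have CJ : (C4 + kap - be) * J%:R <= `|(C4 + kap - be) * J%:R| by rewrite ler_norm.
  by rewrite mulrBl in key; rewrite /D in DD; rewrite -/(u n) in fn; lra.
have /andP[s0 sr] := expN_le i r r0.
exists (expR (- i%:R) * r); first by rewrite s0 (le_lt_trans sr).
move=> j jJ; have := hi j jJ; rewrite /u expND.
have /andP[h1 h2] := expN_le j _ s0.
have [+ _] := f_quasi _ _ _ h1 h2 sr rr1; lra.
Qed.

End GoodScales.

(** * The main theorem *)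

Section ExtremalTangents.
Context {R : realType} {X : Type} (d : X -> X -> R) (x : X) (c a : R).
Hypotheses (hd : is_metric d) (hc : 1 <= c) (ha0 : 0 < a).
Hypothesis hdoub : forall r lam mu : R, 0 < r -> r <= a -> 0 < lam -> lam <= 1 ->
  0 < mu -> mu <= 1 -> forall y z : X, oball d x r y -> oball d x r z ->
  (covnum d (lam * mu * r) (oball d y (lam * r))
     <= c%:E * covnum d (lam * mu * r) (oball d z (lam * r)))%E.
Hypothesis hfin : forall lam : R, 0 < lam ->
  (limf_esup (fun r => covnum d (lam * r) (cball d x r)) (0^'+) < +oo)%E.

Let f := logcov d x.

(* Rescaling by the good scales, a tangent inherits the bound [P j] at every
   level [j], since along the sequence it holds for all [j <= k]. *)
Lemma tangent_at_good_scales (P : nat -> R -> Prop) :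
  (forall (J : nat) (e : R), 0 < e -> exists2 s, 0 < s < e &
    forall j, (j <= J)%N -> P j (f (expR (- j%:R) * s) s)) ->
  exists (T : Type) (dT : T -> T -> R) (q : T), is_tangent d x dT q /\
    forall (rho rho' S S' : R) (j : nat) (e : R),
      0 < rho' -> rho' < rho -> 0 < S -> S < S' -> 0 < e ->
      exists2 s, 0 < s < e & [/\ P j (f (expR (- j%:R) * s) s),
        (covnum dT rho (oball dT q S) <= covnum d (rho' * s) (oball d x (S' * s)))%E &
        (covnum d (rho * s) (oball d x (S * s)) <= covnum dT rho' (oball dT q S'))%E].
Proof.
move=> good.
have /choice[s sP] (k : nat) : exists s, 0 < s < k.+1%:R^-1 /\
    forall j, (j <= k)%N -> P j (f (expR (- j%:R) * s) s).
  have k0 : 0 < k.+1%:R^-1 :> R by rewrite invr_gt0 ltr0n.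
  by have [s sk sP] := good k _ k0; exists s.
have s0 k : 0 < s k by have [/andP[]] := sP k.
have sk k : s k < k.+1%:R^-1 by have [/andP[]] := sP k.
have [T [dT [q [phi [mT mphi toy conv]]]]] :=
  tangent_along_subsequence d x s hd (fin_covers d x hfin) s0 sk.
exists T, dT, q; split; first by split=> //; exists (fun k => (s (phi k))^-1).
move=> rho rho' S S' j e rho'0 rho'r S0 SS' e0.
have [k1 hk1] := tangent_covnum d x hd T dT q _ mT toy conv _ _ _ _ rho'0 rho'r S0 SS'.
(* Since [phi k >= k >= j], the scale [s (phi k)] is good at level [j]. *)
have [k2 hk2] := toy e^-1; pose k := maxn j (maxn k1 k2).
have [jk k1k k2k] : [/\ (j <= k)%N, (k1 <= k)%N & (k2 <= k)%N].
  by rewrite /k !leq_max !leqnn !orbT.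
have [le1 le2] := hk1 k k1k; rewrite !invrK in le1 le2.
exists (s (phi k)).
  rewrite s0 -[ltLHS]invrK -[ltRHS]invrK ltf_pV2 ?posrE ?invr_gt0//; exact: hk2.
by split=> //; apply: (sP (phi k)).2; exact: leq_trans (mphi k).
Qed.

(** For every [S], passing from the ball of radius [2 * S * s] to that of radius [s] costs at most
    [C' + kap], independently of [r]. The good scale bounds what remains at a level [j] that grows
    as [r] decreases, hence the need for all levels in one tangent set. *)
Lemma tangent_box_dim_up_le (be : R) : (tang_dim_low d x < be%:E)%E ->
  exists (T : Type) (dT : T -> T -> R) (q : T),
    is_tangent d x dT q /\ (box_dim_up dT q <= be%:E)%E.
Proof.
have [r1 [kap [r10 fE f_mono f_quasi f_bnd]]] :=
  logcov_quasi_additive d x c a hd hc ha0 hdoub hfin.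
move=> /(good_scales_low d x r1 kap hd r10 fE f_mono f_quasi)[C good].
have [T [dT [q [tT tP]]]] :=
  tangent_at_good_scales (fun j v => v <= be * j%:R + C) good.
exists T, dT, q; split=> //.
apply: box_dim_up_le => S S1; have S0 : 0 < S by lra.
have S20 : 0 < 2 * S by lra.
have [C' [e' [e'0 fC']]] := f_bnd (2 * S) S20.
apply: (growth_esup_le _ _ (be * ln 2 + `|be| + C + C' + kap) 1) => // r /andP[r0 rlt1].
apply/andP; split; first by apply: covnum_ge1; apply: oball_center => //; exact: tT.1.
pose L := ln (r / 2)^-1.
have LE : L = ln r^-1 + ln 2.
  by rewrite /L invf_div lnM ?posrE ?invr_gt0// addrC.
have L0 : 0 <= L by rewrite /L ln_ge0// invf_ge1//; lra.
(* Rounding up gives [expR (- j) <= r / 2]; it costs at most [|be|] whatever the sign of [be]. *)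
pose j := (Num.truncn L).+1; have /andP[jL Lj] := truncn_itv L0; rewrite -/j in Lj.
have {}jL : j%:R <= L + 1 by rewrite /j -natr1 lerD2r.
have m0 : 0 < Num.min e' (r1 / (2 * S)) by rewrite lt_min e'0 divr_gt0.
have [||||s] := tP r (r / 2) S (2 * S) j _ _ _ _ _ m0; [lra|lra|lra|lra|].
rewrite lt_min ltr_pdivlMr// => /and3P[s0 se sr1] [fj le _].
apply: le_trans le _.
have rs0 : 0 < r / 2 * s by rewrite mulr_gt0// divr_gt0.
have rss : r / 2 * s <= s by rewrite ler_piMl ?(ltW s0)//; lra.
have sS : s <= 2 * S * s by rewrite ler_peMl ?(ltW s0)//; lra.
have Ss1 : 2 * S * s < r1 by rewrite mulrC.
have [|-> _] := fE (r / 2 * s) (2 * S * s) rs0; first by rewrite Ss1 mulr_gt0.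
rewrite lee_fin ler_expR.
have [q1 _] := f_quasi _ _ _ rs0 rss sS Ss1.
have q2 : f s (2 * S * s) <= C' by apply: fC'; rewrite s0.
have ejr : expR (- j%:R) * s <= r / 2 * s.
  rewrite ler_pM2r// -[r / 2]invrK -[(r / 2)^-1]lnK ?posrE ?invr_gt0 ?divr_gt0//.
  by rewrite -expRN ler_expR lerN2 ltW.
have q3 : f (r / 2 * s) s <= f (expR (- j%:R) * s) s.
  apply: f_mono => //; first by rewrite mulr_gt0 ?expR_gt0.
  exact: le_lt_trans Ss1.
have bj : be * j%:R <= be * L + `|be|.
  by have [be0|be0] := ger0P be; nra.
rewrite LE mulrDr in bj; rewrite /f in q1 q2 q3 fj *; lra.
Qed.

(** For a lower bound one ball of the tangent set is enough: its covering number at [r] dominates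
    that of the ball of radius [s] in [X] at [2 * r * s]. *)
Lemma tangent_box_dim_low_ge (be : R) : (be%:E < tang_dim_up d x)%E ->
  exists (T : Type) (dT : T -> T -> R) (q : T),
    is_tangent d x dT q /\ (be%:E <= box_dim_low dT q)%E.
Proof.
have [r1 [kap [r10 fE f_mono f_quasi f_bnd]]] :=
  logcov_quasi_additive d x c a hd hc ha0 hdoub hfin.
move=> /(good_scales_up d x r1 kap hd r10 fE f_mono f_quasi f_bnd)[C good].
have [T [dT [q [tT tP]]]] :=
  tangent_at_good_scales (fun j v => be * j%:R - C <= v) good.
exists T, dT, q; split=> //.
apply: (box_dim_low_ge _ _ 2).
apply: (growth_einf_ge _ _ (be * ln 2 + `|be| + C) (1 / 2)) => [|r /andP[r0 rlt1]].
  by rewrite divr_gt0.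
have r20 : 0 < 2 * r by rewrite mulr_gt0.
pose L := ln (2 * r)^-1.
have LE : L = ln r^-1 - ln 2.
  by rewrite /L !lnV ?posrE// lnM ?posrE// opprD addrC.
have L0 : 0 <= L by rewrite /L ln_ge0// invf_ge1//; lra.
(* Rounding down makes [expR (- j)] at least [2 * r], the direction needed for a lower bound. *)
pose j := Num.truncn L; have /andP[jL Lj] := truncn_itv L0; rewrite -/j in jL Lj.
rewrite -natr1 in Lj.
have [||||s] := tP (2 * r) r 1 2 j _ _ _ _ _ r10; [lra|lra|lra|lra|].
move=> /andP[s0 sr1] [fj _ le]; apply: le_trans le; rewrite mul1r.
have rs0 : 0 < 2 * r * s by rewrite mulr_gt0.
have [|-> _] := fE (2 * r * s) s rs0; first by rewrite s0.
rewrite lee_fin ler_expR.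
have ejr : 2 * r * s <= expR (- j%:R) * s.
  rewrite ler_pM2r// -[2 * r]invrK -[(2 * r)^-1]lnK ?posrE ?invr_gt0//.
  by rewrite -expRN ler_expR lerN2.
have q3 : f (expR (- j%:R) * s) s <= f (2 * r * s) s by apply: f_mono.
have bj : be * L - `|be| <= be * j%:R.
  by have [be0|be0] := ger0P be; nra.
rewrite LE mulrBr in bj; rewrite /f in q3 fj *; lra.
Qed.

End ExtremalTangents.

Theorem theorem4p8 (R : realType) (X : Type) (d : X -> X -> R) (x : X)
  (hd : is_metric d) (c a : R) (hc : 1 <= c) (ha0 : 0 < a) (ha1 : a <= 1)
  (hdoub : forall r lam mu : R, 0 < r -> r <= a -> 0 < lam -> lam <= 1 ->
     0 < mu -> mu <= 1 -> forall y z : X, oball d x r y -> oball d x r z ->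
     (covnum d (lam * mu * r) (oball d y (lam * r))
        <= c%:E * covnum d (lam * mu * r) (oball d z (lam * r)))%E)
  (hfin : forall lam : R, 0 < lam ->
     (limf_esup (fun r => covnum d (lam * r) (cball d x r)) (0^'+) < +oo)%E) :
  tang_dim_low d x = ereal_inf (tangent_low_dims d x) /\
  ereal_inf (tangent_low_dims d x) = ereal_inf (tangent_up_dims d x) /\
  tang_dim_up d x = ereal_sup (tangent_low_dims d x) /\
  ereal_sup (tangent_low_dims d x) = ereal_sup (tangent_up_dims d x).
Proof.
set iL := ereal_inf (tangent_low_dims d x); set iU := ereal_inf (tangent_up_dims d x).
set sL := ereal_sup (tangent_low_dims d x); set sU := ereal_sup (tangent_up_dims d x).
(* Two cycles of inequalities give the four equalities: the lower dimension, [iL], [iU] and back,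
   then the upper dimension, [sL], [sU] and back. *)
have low_iL : (tang_dim_low d x <= iL)%E.
  apply: le_ereal_inf_tmp => _ [T [dT [q [tT ->]]]].
  exact: tang_dim_low_le_box_dim_low.
have iL_iU : (iL <= iU)%E.
  apply: le_ereal_inf_tmp => _ [T [dT [q [tT ->]]]].
  apply: le_trans (box_dim_low_le_up dT q).
  by apply: ereal_inf_lbound; exists T, dT, q.
have iU_low : (iU <= tang_dim_low d x)%E.
  apply: lee_lt_EFin => b /(tangent_box_dim_up_le d x c a hd hc ha0 hdoub hfin).
  move=> [T [dT [q [tT le]]]]; apply: le_trans le.
  by apply: ereal_inf_lbound; exists T, dT, q.
have sU_up : (sU <= tang_dim_up d x)%E.
  apply: ge_ereal_sup => _ [T [dT [q [tT ->]]]].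
  exact: box_dim_up_le_tang_dim_up.
have sL_sU : (sL <= sU)%E.
  apply: ge_ereal_sup => _ [T [dT [q [tT ->]]]].
  apply: le_trans (box_dim_low_le_up dT q) _.
  by apply: ereal_sup_ubound; exists T, dT, q.
have up_sL : (tang_dim_up d x <= sL)%E.
  apply: lee_EFin_lt => b /(tangent_box_dim_low_ge d x c a hd hc ha0 hdoub hfin).
  move=> [T [dT [q [tT le]]]]; apply: le_trans le _.
  by apply: ereal_sup_ubound; exists T, dT, q.
split; first by apply/eqP; rewrite eq_le low_iL (le_trans iL_iU).
split; first by apply/eqP; rewrite eq_le iL_iU (le_trans iU_low).
split; first by apply/eqP; rewrite eq_le up_sL (le_trans sL_sU).
by apply/eqP; rewrite eq_le sL_sU (le_trans sU_up).
Qed.
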